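(* If a function $f\in\mathcal{A}_1$ satisfies the condition $$ \left|\operatorname{Im}\left[\frac{zf''(z)}{f'(z)}\right]\right|<\sqrt3, \qquad z\in\mathbb{D}, $$ then $f$ is starlike.
   Context: $\mathbb{D}=\{z\in\mathbb{C}:|z|<1\}$. $\mathcal{A}_1$ is the class of holomorphic functions $f$ on $\mathbb{D}$ with $f(0)=f'(0)-1=0$. A function $f\in\mathcal{A}_1$ is called starlike if $f$ maps $\mathbb{D}$ univalently onto a domain starlike with respect to the origin (equivalently, $zf'(z)/f(z)$ is holomorphic with positive real part on $\mathbb{D}$). The displayed condition includes that $zf''/f'$ has no poles in $\mathbb{D}$, i.e. $f'$ has no zeros in $\mathbb{D}$. *)

(* Defs.v *)
From Stdlib Require Import Reals.
From Coquelicot Require Import Coquelicot.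

Open Scope R_scope.

Definition unit_disc (z : C) : Prop := Cmod z < 1.

(* Functions on a subset of C are total functions C -> C whose values outside
   the subset are irrelevant.  Over the scalars C_AbsRing, ex_derive is complex
   differentiability. *)
Definition holomorphic_on (A : C -> Prop) (f : C -> C) : Prop :=
  forall z : C, A z -> ex_derive (K := C_AbsRing) (V := C_NormedModule) f z.

Definition univalent_on (A : C -> Prop) (f : C -> C) : Prop :=
  holomorphic_on A f /\
  forall z1 z2 : C, A z1 -> A z2 -> f z1 = f z2 -> z1 = z2.

Definition image (A : C -> Prop) (f : C -> C) : C -> Prop :=
  fun w => exists z : C, A z /\ f z = w.

Definition connected (A : C -> Prop) : Prop :=
  forall U V : C -> Prop,
    open (T := C_UniformSpace) U -> open (T := C_UniformSpace) V ->
    (forall z, A z -> U z \/ V z) ->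
    (exists z, A z /\ U z) -> (exists z, A z /\ V z) ->
    exists z, A z /\ U z /\ V z.

Definition domain (A : C -> Prop) : Prop :=
  open (T := C_UniformSpace) A /\ (exists z, A z) /\ connected A.

Definition starlike_wrt_origin (A : C -> Prop) : Prop :=
  A 0%C /\
  forall (w : C) (t : R), A w -> 0 <= t <= 1 -> A (RtoC t * w)%C.

Definition class_A1 (f : C -> C) : Prop :=
  holomorphic_on unit_disc f /\ f 0%C = 0%C /\ (C_derive f 0 - 1)%C = 0%C.

Definition starlike (f : C -> C) : Prop :=
  univalent_on unit_disc f /\
  domain (image unit_disc f) /\
  starlike_wrt_origin (image unit_disc f).

(* Main.v *)
(* Put p = f / (z f'), so p(0) = 1, and P = z f'' / f'; then z p' = 1 - (1 + P) p.
   If Re p vanished somewhere, take such a point z0 of least modulus, p(z0) = i b.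
   Schwarz's lemma for (1 - p) / (1 + p) on |z| < |z0| gives, at the boundary point
   z0, that z0 p'(z0) is real and at most -(1 + b^2) / 2.  The real part of the
   equation then reads 1 - z0 p'(z0) = - b Im P, so |b| |Im P| >= (3 + b^2) / 2
   >= sqrt 3 |b|, a contradiction.  Hence Re p > 0 on the disc.

   Solving f(u') = (1 - t) f(u) near u gives u' = u (1 - t p(u)) + o(t), which is
   closer to the origin than u.  Compactness turns this into starlikeness (minimise
   s among the solutions of f(u) = s f(z0) with |u| <= |z0|) and injectivity
   (minimise |f(u)| among the u for which f(v) = f(u) has a solution v <> u).

   Complex differentiability of f' comes from Goursat's bisection argument applied
   in polar coordinates, which yields the mean value property, then Cauchy's
   estimate for the difference quotients of f. *)

Require Import Defs.
From Stdlib Require Import Reals Lra Classical ClassicalEpsilon.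
From Coquelicot Require Import Coquelicot.

Open Scope R_scope.

(** * Bisection and compactness *)

(** Why [p] and not its reciprocal z f' / f: zero-freeness of f' is given, while zeros of f off the
    origin are excluded only as a consequence of Re p > 0. So [p] is holomorphic from the start,
    apart from a removable singularity at 0 that is filled in by hand. The constant sqrt 3 is the
    exact threshold of the boundary estimate: (3 + b^2) / 2 - sqrt 3 |b| = (|b| - sqrt 3)^2 / 2
    vanishes at |b| = sqrt 3, so the strict inequality in the hypothesis is what produces the
    contradiction. The main obstacle is that holomorphy means pointwise complex differentiability.
    Neither continuity of f' nor the meaning of [C_derive (C_derive f)] comes for free, and both are
    obtained from circle averages of real parts; a unimodular rotation turns bounds on real parts
    into bounds on moduli. Preimages are found by minimising |f - w| over a closed disc. The inward
    motion is a single small step applied to a minimiser, so no flow and no lifting of paths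
    enters. *)

Definition cderiv (f : C -> C) (z l : C) : Prop :=
  forall eps, 0 < eps -> exists d, 0 < d /\
    forall h, Cmod h < d -> Cmod (f (z + h) - f z - l * h)%C <= eps * Cmod h.

Lemma cderiv_is_derive (f : C -> C) (z l : C) :
  cderiv f z l <-> is_derive (K := C_AbsRing) (V := C_NormedModule) f z l.
Proof.
split.
- intros H. split; [apply is_linear_scal_l|].
  intros x Hx.
  apply (is_filter_lim_locally_unique (V := AbsRing_NormedModule C_AbsRing)) in Hx. subst x.
  intros eps. destruct (H eps (cond_pos eps)) as [d [Hd H1]].
  exists (mkposreal d Hd). intros y Hy.
  change (Cmod (y - z)%C < d) in Hy.
  change (Cmod ((f y - f z) - (y - z) * l)%C <= eps * Cmod (y - z)%C).
  specialize (H1 _ Hy). assert (E : @eq C (z + (y - z))%C y) by ring. rewrite E in H1.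
  rewrite (Cmult_comm (y - z) l). exact H1.
- intros [_ H] eps He.
  specialize (H z (fun P HP => HP) (mkposreal eps He)).
  destruct H as [d Hd]. exists d. split; [apply cond_pos|].
  intros h Hh. specialize (Hd (z + h)%C).
  change (Cmod ((z + h) - z)%C < d ->
    Cmod ((f (z + h)%C - f z) - ((z + h) - z) * l)%C <= eps * Cmod ((z + h) - z)%C) in Hd.
  assert (E : @eq C ((z + h) - z)%C h) by ring. rewrite E in Hd.
  rewrite (Cmult_comm l h). now apply Hd.
Qed.

Lemma C_derive_cderiv (f : C -> C) (z l : C) : cderiv f z l -> C_derive f z = l.
Proof. intros H. apply is_C_derive_unique. now apply cderiv_is_derive. Qed.

(** If [Q] failed at scale 1, it would fail on one of the four quarters, and so on; the nested bad
    rectangles shrink to a point (x, y), where the local hypothesis is violated. [Q a c t] speaks of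
    [a, a + al t] x [c, c + be t]. The same bisection drives both compactness and Goursat's
    argument. *)
Lemma dyadic_rectangle_induction (al be a0 c0 : R) (Q : R -> R -> R -> Prop) :
  0 <= al -> 0 <= be ->
  (forall a c t, 0 < t ->
     a0 <= a -> a + al * t <= a0 + al -> c0 <= c -> c + be * t <= c0 + be ->
     Q a c (t / 2) -> Q (a + al * (t / 2)) c (t / 2) ->
     Q a (c + be * (t / 2)) (t / 2) ->
     Q (a + al * (t / 2)) (c + be * (t / 2)) (t / 2) -> Q a c t) ->
  (forall x y, a0 <= x <= a0 + al -> c0 <= y <= c0 + be ->
     exists d, 0 < d /\ forall a c t, 0 < t < d ->
       a0 <= a -> a + al * t <= a0 + al -> c0 <= c -> c + be * t <= c0 + be ->
       a <= x <= a + al * t -> c <= y <= c + be * t -> Q a c t) ->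
  Q a0 c0 1.
Proof.
intros Hal Hbe Hsplit Hloc. apply NNPP. intros Hn.
pose (bad := fun (p : R * R) t =>
  a0 <= fst p /\ fst p + al * t <= a0 + al /\
  c0 <= snd p /\ snd p + be * t <= c0 + be /\ ~ Q (fst p) (snd p) t).
pose (child := fun (p q : R * R) t =>
  fst p <= fst q /\ fst q + al * (t / 2) <= fst p + al * t /\
  snd p <= snd q /\ snd q + be * (t / 2) <= snd p + be * t).
assert (Hstep : forall p t, 0 < t -> bad p t ->
  exists q, child p q t /\ bad q (t / 2)).
{ intros [a c] t Ht (H1 & H2 & H3 & H4 & H5). simpl in *.
  assert (0 <= al * (t / 2)) by (apply Rmult_le_pos; lra).
  assert (0 <= be * (t / 2)) by (apply Rmult_le_pos; lra).
  assert (al * t = 2 * (al * (t / 2))) by field.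
  assert (be * t = 2 * (be * (t / 2))) by field.
  apply NNPP. intros Hno. apply H5. apply Hsplit; trivial; apply NNPP; intros HQ; apply Hno.
  - exists (a, c). unfold child, bad; simpl. repeat split; trivial; lra.
  - exists (a + al * (t / 2), c). unfold child, bad; simpl. repeat split; trivial; lra.
  - exists (a, c + be * (t / 2)). unfold child, bad; simpl. repeat split; trivial; lra.
  - exists (a + al * (t / 2), c + be * (t / 2)). unfold child, bad; simpl. repeat split; trivial; lra. }
(* Choice of a bad quarter. The default [p] is never reached along [u], all of whose terms are
   bad. *)
pose (next := fun p t => match excluded_middle_informative
   (exists q, child p q t /\ bad q (t / 2)) with
   | left H => proj1_sig (constructive_indefinite_description _ H) | right _ => p end).
assert (Hnext : forall p t, 0 < t -> bad p t -> child p (next p t) t /\ bad (next p t) (t / 2)).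
{ intros p t Ht Hb. unfold next. destruct excluded_middle_informative as [H|H].
  - exact (proj2_sig (constructive_indefinite_description _ H)).
  - exfalso. apply H. now apply Hstep. }
pose (u := fix u n := match n with O => (a0, c0) | S n => next (u n) ((/ 2) ^ n) end).
assert (Hpos : forall n, 0 < (/ 2) ^ n) by (intros n; apply pow_lt; lra).
assert (Hbad : forall n, bad (u n) ((/ 2) ^ n)).
{ induction n as [|n IH].
  - unfold bad; simpl. repeat split; try lra. exact Hn.
  - replace ((/ 2) ^ S n) with ((/ 2) ^ n / 2) by (simpl; field).
    apply Hnext; trivial. }
assert (Hch : forall n, child (u n) (u (S n)) ((/ 2) ^ n)) by (intros n; now apply Hnext).
assert (Hmono : forall n m, fst (u n) <= fst (u (n + m)%nat) /\
   fst (u (n + m)%nat) + al * (/ 2) ^ (n + m) <= fst (u n) + al * (/ 2) ^ n /\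
   snd (u n) <= snd (u (n + m)%nat) /\
   snd (u (n + m)%nat) + be * (/ 2) ^ (n + m) <= snd (u n) + be * (/ 2) ^ n).
{ intros n m. induction m as [|m IH].
  - rewrite Nat.add_0_r. repeat split; lra.
  - rewrite Nat.add_succ_r. destruct (Hch (n + m)%nat) as (K1 & K2 & K3 & K4).
    replace ((/ 2) ^ S (n + m)) with ((/ 2) ^ (n + m) / 2) by (simpl; field).
    repeat split; lra. }
(* Nested intervals: the supremum of the left endpoints lies in all of them. *)
assert (Hpt : forall (s : nat -> R) (ga : R), 0 <= ga ->
   (forall n m, s n <= s (n + m)%nat /\ s (n + m)%nat + ga * (/ 2) ^ (n + m) <= s n + ga * (/ 2) ^ n) ->
   exists x, forall n, s n <= x <= s n + ga * (/ 2) ^ n).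
{ intros s ga Hga Hs.
  assert (Hup : forall n m, s m <= s n + ga * (/ 2) ^ n).
  { intros n m. destruct (Hs n m) as [_ K1]. destruct (Hs m n) as [K2 _].
    rewrite (Nat.add_comm m n) in K2.
    assert (0 <= ga * (/ 2) ^ (n + m)) by (apply Rmult_le_pos; [lra|left; apply Hpos]). lra. }
  destruct (completeness (fun x => exists n, x = s n)) as [x [Hx1 Hx2]].
  - exists (s O + ga * (/ 2) ^ 0). intros y [n ->]. apply Hup.
  - exists (s O). now exists O.
  - exists x. intros n. split.
    + apply Hx1. now exists n.
    + apply Hx2. intros y [m ->]. apply Hup. }
destruct (Hpt (fun n => fst (u n)) al Hal) as [x Hx].
{ intros n m; destruct (Hmono n m) as (? & ? & _); split; trivial. }
destruct (Hpt (fun n => snd (u n)) be Hbe) as [y Hy].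
{ intros n m; destruct (Hmono n m) as (_ & _ & ? & ?); split; trivial. }
pose proof (Hx O) as Hx0. pose proof (Hy O) as Hy0. simpl in Hx0, Hy0. rewrite Rmult_1_r in *.
destruct (Hloc x y Hx0 Hy0) as [d [Hd H]].
destruct (pow_lt_1_zero (/ 2)) with (y := d) as [N HN]; trivial.
{ rewrite Rabs_pos_eq; lra. }
specialize (HN N (le_n N)). rewrite Rabs_pos_eq in HN by (left; apply Hpos).
destruct (Hbad N) as (K1 & K2 & K3 & K4 & K5). apply K5. apply H; trivial.
split; trivial.
Qed.

Lemma Cmod_le_Re_Im (z : C) : Cmod z <= Rabs (Re z) + Rabs (Im z).
Proof.
destruct z as [x y]. unfold Cmod, Re, Im; simpl.
apply Rsqr_incr_0_var; [|generalize (Rabs_pos x) (Rabs_pos y); lra].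
rewrite Rsqr_sqrt by nra. unfold Rsqr.
replace (x * (x * 1) + y * (y * 1)) with (Rabs x * Rabs x + Rabs y * Rabs y).
- generalize (Rabs_pos x) (Rabs_pos y); nra.
- rewrite <- !Rabs_mult, !Rabs_pos_eq by nra. ring.
Qed.

Lemma im_le_Cmod (z : C) : Rabs (Im z) <= Cmod z.
Proof. apply Rle_trans with (2 := Rmax_Cmod z). apply Rmax_r. Qed.

(** Heine-Borel as an induction principle: a property inherited by subsets and by binary unions
    passes from small pieces to [K]. The local hypothesis ranges over all points of the plane; at
    points outside [K] it is where closedness enters in applications. *)
Lemma compact_induction (K : C -> Prop) (M : R) (Q : (C -> Prop) -> Prop) :
  (forall z, K z -> Cmod z <= M) ->
  (forall A B : C -> Prop, (forall z, A z -> B z) -> Q B -> Q A) ->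
  (forall A B, Q A -> Q B -> Q (fun z => A z \/ B z)) ->
  (forall z, exists d, 0 < d /\ Q (fun w => K w /\ Cmod (w - z)%C < d)) ->
  Q K.
Proof.
intros HK Hmono Hun Hloc.
(* A point of [K] supplies [0 <= M]; an empty [K] is contained in any local piece. *)
destruct (classic (exists z, K z)) as [[z0 Hz0]|Hemp].
2:{ destruct (Hloc 0%C) as [d [_ H]]. apply Hmono with (2 := H).
  intros z Hz. exfalso; apply Hemp; now exists z. }
assert (HM : 0 <= M) by (apply Rle_trans with (2 := HK _ Hz0); apply Cmod_ge_0).
apply Hmono with (B := fun z => K z /\ - M <= Re z <= - M + 2 * M * 1 /\ - M <= Im z <= - M + 2 * M * 1).
{ intros z Hz. specialize (HK z Hz). split; trivial.
  generalize (re_le_Cmod z) (im_le_Cmod z). intros H1 H2.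
  apply Rabs_le_between in H1. apply Rabs_le_between in H2. lra. }
apply (dyadic_rectangle_induction (2 * M) (2 * M) (- M) (- M) (fun a c t =>
  Q (fun z => K z /\ a <= Re z <= a + 2 * M * t /\ c <= Im z <= c + 2 * M * t))); try lra.
- intros a c t Ht _ _ _ _ H1 H2 H3 H4.
  assert (E : 2 * M * t = 2 * (2 * M * (t / 2))) by field.
  apply Hmono with (2 := Hun _ _ (Hun _ _ H1 H2) (Hun _ _ H3 H4)).
  intros z (Hz & Hx & Hy).
  destruct (Rle_dec (Re z) (a + 2 * M * (t / 2)));
  destruct (Rle_dec (Im z) (c + 2 * M * (t / 2)));
  [left; left|right; left|left; right|right;right]; (split; [trivial|lra]).
- intros x y _ _. destruct (Hloc (x, y)) as [d [Hd H]].
  (* A square of side 2 M t containing (x, y) stays within 4 M t of it; the added 1 covers M = 0. *)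
  exists (d / (4 * M + 1)). split; [apply Rdiv_lt_0_compat; lra|].
  intros a c t [Ht1 Ht2] _ _ _ _ Hx Hy. apply Hmono with (2 := H).
  intros w (Hw & Hw1 & Hw2). split; trivial.
  apply Rmult_lt_compat_r with (r := 4 * M + 1) in Ht2; [|lra].
  replace (d / (4 * M + 1) * (4 * M + 1)) with d in Ht2 by (field; lra).
  apply Rle_lt_trans with (1 := Cmod_le_Re_Im _).
  apply Rle_lt_trans with (2 * M * t + 2 * M * t); [|nra].
  apply Rplus_le_compat; apply Rabs_le; unfold Re, Im in *; simpl; lra.
Qed.

(** Without a minimum, each point of [K] is beaten by some [w0], which by continuity beats a whole
    neighbourhood. Of two such witnesses the better one serves the union, so one witness would beat
    all of [K], itself included. The second hypothesis is closedness of [K]. *)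
Lemma compact_min (K : C -> Prop) (M : R) (phi : C -> R) :
  (forall z, K z -> Cmod z <= M) ->
  (forall z, ~ K z -> exists d, 0 < d /\ forall w, Cmod (w - z)%C < d -> ~ K w) ->
  (forall z, K z -> forall eps, 0 < eps -> exists d, 0 < d /\
     forall w, K w -> Cmod (w - z)%C < d -> Rabs (phi w - phi z) < eps) ->
  (exists z, K z) ->
  exists z, K z /\ forall w, K w -> phi z <= phi w.
Proof.
intros Hb Hc Hphi [z0 Hz0]. apply NNPP. intros Hn.
assert (H : exists w0, K w0 /\ forall w, K w -> K w -> phi w0 < phi w).
{ apply (compact_induction K M (fun A => exists w0, K w0 /\ forall w, A w -> K w -> phi w0 < phi w)); trivial.
  - intros A B HAB (w0 & H1 & H2). exists w0. split; auto.
  - intros A B (w1 & H1 & H2) (w2 & H3 & H4).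
    destruct (Rle_dec (phi w1) (phi w2)).
    + exists w1. split; trivial. intros w [Hw|Hw] Kw; auto. specialize (H4 w Hw Kw). lra.
    + exists w2. split; trivial. intros w [Hw|Hw] Kw; auto. specialize (H2 w Hw Kw). lra.
  - intros z. destruct (classic (K z)) as [Kz|Kz].
    + assert (exists w0, K w0 /\ phi w0 < phi z) as (w0 & H1 & H2).
      { apply NNPP. intros H. apply Hn. exists z. split; trivial.
        intros w Kw. apply Rnot_lt_le. intros Hlt. apply H. now exists w. }
      destruct (Hphi z Kz (phi z - phi w0)) as [d [Hd H]]; [lra|].
      exists d. split; trivial. exists w0. split; trivial.
      intros w [_ Hw] Kw. specialize (H w Kw Hw). apply Rabs_lt_between in H. lra.
    + destruct (Hc z Kz) as [d [Hd H]]. exists d. split; trivial. exists z0. split; trivial.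
      intros w [Kw Hw]. now elim (H w Hw). }
destruct H as (w0 & H1 & H2). specialize (H2 w0 H1 H1). lra.
Qed.

(** * Goursat's lemma for closed real forms *)

Lemma differentiable_pt_lim_section_x (A : R -> R -> R) x y l m :
  differentiable_pt_lim A x y l m -> derivable_pt_lim (fun u => A u y) x l.
Proof.
intros H. replace l with (l * 1 + m * 0) by ring.
apply (derivable_pt_lim_comp_2d A (fun u => u) (fun _ => y)); trivial.
- apply derivable_pt_lim_id.
- apply derivable_pt_lim_const.
Qed.

Lemma differentiable_pt_lim_section_y (A : R -> R -> R) x y l m :
  differentiable_pt_lim A x y l m -> derivable_pt_lim (fun v => A x v) y m.
Proof.
intros H. replace m with (l * 0 + m * 1) by ring.
apply (derivable_pt_lim_comp_2d A (fun _ => x) (fun v => v)); trivial.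
- apply derivable_pt_lim_const.
- apply derivable_pt_lim_id.
Qed.

Lemma derivable_pt_lim_continuous (f : R -> R) x l :
  derivable_pt_lim f x l -> continuous f x.
Proof.
intros H. apply (ex_derive_continuous (K := R_AbsRing) (V := R_NormedModule)).
exists l. now apply is_derive_Reals.
Qed.

(** Used for the linearised sides of a small rectangle, and with [l] equal to 0 for circle averages
    of a nearly constant function. *)
Lemma RInt_near_affine (phi : R -> R) a b k l x0 delta :
  a <= b -> ex_RInt phi a b ->
  (forall t, a <= t <= b -> Rabs (phi t - (k + l * (t - x0))) <= delta) ->
  Rabs (RInt phi a b - (k * (b - a) + l * ((b - x0) ^ 2 - (a - x0) ^ 2) / 2))
    <= (b - a) * delta.
Proof.
intros Hab Hex H.
assert (Haff : is_RInt (fun t => k + l * (t - x0)) a b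
   (k * (b - a) + l * ((b - x0) ^ 2 - (a - x0) ^ 2) / 2)).
{ replace (k * (b - a) + l * ((b - x0) ^ 2 - (a - x0) ^ 2) / 2) with
    (minus (k * b + l * (b - x0) ^ 2 / 2) (k * a + l * (a - x0) ^ 2 / 2))
    by (unfold minus, plus, opp; simpl; field).
  apply (is_RInt_derive (V := R_CompleteNormedModule) (fun t => k * t + l * (t - x0) ^ 2 / 2)).
  - intros t _. auto_derive; trivial. simpl; field.
  - intros t _. apply (ex_derive_continuous (K := R_AbsRing) (V := R_NormedModule)).
    auto_derive; trivial. }
rewrite <- (is_RInt_unique _ _ _ _ Haff).
change (Rabs (minus (RInt phi a b) (RInt (fun t => k + l * (t - x0)) a b)) <= (b - a) * delta).
rewrite <- RInt_minus; [|trivial|eexists; exact Haff].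
apply abs_RInt_le_const; trivial.
apply (ex_RInt_minus (V := R_CompleteNormedModule)); [trivial|eexists; exact Haff].
Qed.

(** The counterclockwise circulation of A dx + B dy around [a, b] x [c, d]. *)
Definition boundary_integral (A B : R -> R -> R) a b c d :=
  RInt (fun x => A x c) a b + RInt (B b) c d - RInt (fun x => A x d) a b - RInt (B a) c d.

(* Goursat's argument: only pointwise differentiability of the closed form
   [A dx + B dy] is used, no continuity of its partial derivatives. *)
Lemma closed_form_boundary_integral (A B : R -> R -> R) a0 b0 c0 d0 :
  a0 <= b0 -> c0 <= d0 ->
  (forall x y, a0 <= x <= b0 -> c0 <= y <= d0 -> exists l m n,
     differentiable_pt_lim A x y l m /\ differentiable_pt_lim B x y m n) ->
  boundary_integral A B a0 b0 c0 d0 = 0.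
Proof.
intros Hab Hcd HAB.
assert (IA : forall a b c, a0 <= a <= b -> b <= b0 -> c0 <= c <= d0 -> ex_RInt (fun x => A x c) a b).
{ intros a b c H1 H2 H3. apply (ex_RInt_continuous (V := R_CompleteNormedModule)). intros x Hx.
  rewrite Rmin_left, Rmax_right in Hx by lra.
  destruct (HAB x c) as (l & m & n & H & _); try lra.
  eapply derivable_pt_lim_continuous, differentiable_pt_lim_section_x, H. }
assert (IB : forall c d a, c0 <= c <= d -> d <= d0 -> a0 <= a <= b0 -> ex_RInt (B a) c d).
{ intros c d a H1 H2 H3. apply (ex_RInt_continuous (V := R_CompleteNormedModule)). intros y Hy.
  rewrite Rmin_left, Rmax_right in Hy by lra.
  destruct (HAB a y) as (l & m & n & _ & H); try lra.
  eapply derivable_pt_lim_continuous, differentiable_pt_lim_section_y, H. }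
set (al := b0 - a0). set (be := d0 - c0).
assert (Eb : b0 = a0 + al) by (unfold al; ring). assert (Ed : d0 = c0 + be) by (unfold be; ring).
assert (Hal : 0 <= al) by lra. assert (Hbe : 0 <= be) by lra. clearbody al be.
assert (Hall : forall eps, 0 < eps -> Rabs (boundary_integral A B a0 b0 c0 d0) <= eps).
{ intros eps He.
  (* The bound scales like an area: four quarters with [(t / 2) ^ 2] add up to [t ^ 2], while
     circulations along the common inner sides cancel. *)
  pose proof (dyadic_rectangle_induction al be a0 c0
   (fun a c t => Rabs (boundary_integral A B a (a + al * t) c (c + be * t)) <= eps * t ^ 2) Hal Hbe) as Hind.
  simpl in Hind. rewrite !Rmult_1_r, <- Eb, <- Ed in Hind. apply Hind; clear Hind.
  - intros a c t Ht H1 H2 H3 H4.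
    set (x1 := al * (t / 2)). set (y1 := be * (t / 2)).
    assert (Ex : al * t = x1 + x1) by (unfold x1; field).
    assert (Ey : be * t = y1 + y1) by (unfold y1; field).
    assert (0 <= x1) by (apply Rmult_le_pos; lra). assert (0 <= y1) by (apply Rmult_le_pos; lra).
    rewrite Ex, Ey, <- !Rplus_assoc in *. clearbody x1 y1.
    unfold boundary_integral. intros K1 K2 K3 K4.
    assert (CA : forall z, c0 <= z <= d0 -> RInt (fun x => A x z) a (a + x1 + x1)
       = RInt (fun x => A x z) a (a + x1) + RInt (fun x => A x z) (a + x1) (a + x1 + x1)).
    { intros z Hz. symmetry. apply (RInt_Chasles (V := R_CompleteNormedModule)); apply IA; lra. }
    assert (CB : forall z, a0 <= z <= b0 -> RInt (B z) c (c + y1 + y1)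
       = RInt (B z) c (c + y1) + RInt (B z) (c + y1) (c + y1 + y1)).
    { intros z Hz. symmetry. apply (RInt_Chasles (V := R_CompleteNormedModule)); apply IB; lra. }
    rewrite !CA, !CB by lra.
    apply Rabs_le_between in K1. apply Rabs_le_between in K2.
    apply Rabs_le_between in K3. apply Rabs_le_between in K4.
    apply Rabs_le. lra.
  - intros x y Hx Hy.
    destruct (HAB x y Hx Hy) as (l & m & n & HA & HB).
    pose (L := al + be + 1).
    assert (HL : 0 < L) by (unfold L; lra).
    (* The perimeter is at most 2 t L and the linearisation error at most eta t L, so their product
       is eps t^2 for this [eta]. *)
    assert (Heta : 0 < eps / (2 * L ^ 2)) by (apply Rdiv_lt_0_compat; nra).
    set (eta := mkposreal _ Heta).
    destruct (HA eta) as [d1 H1]. destruct (HB eta) as [d2 H2].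
    pose proof (cond_pos d1) as Hd1. pose proof (cond_pos d2) as Hd2.
    exists (Rmin d1 d2 / L). split; [apply Rdiv_lt_0_compat; [apply Rmin_pos|]; lra|].
    intros a c t [Ht1 Ht2] Ka Kb Kc Kd Kx Ky.
    assert (HtL : t * L < Rmin d1 d2).
    { apply Rmult_lt_compat_r with (r := L) in Ht2; trivial.
      now replace (Rmin d1 d2 / L * L) with (Rmin d1 d2) in Ht2 by (field; lra). }
    assert (Rmin d1 d2 <= d1) by apply Rmin_l. assert (Rmin d1 d2 <= d2) by apply Rmin_r.
    assert (0 <= al * t) by (apply Rmult_le_pos; lra).
    assert (0 <= be * t) by (apply Rmult_le_pos; lra).
    assert (Hclose : forall u v, a <= u <= a + al * t -> c <= v <= c + be * t ->
      Rabs (u - x) <= t * L /\ Rabs (v - y) <= t * L).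
    { intros u v Hu Hv. unfold L. split; apply Rabs_le; nra. }
    set (b := a + al * t) in *. set (d := c + be * t) in *.
    assert (EA : forall u v, a <= u <= b -> c <= v <= d ->
      Rabs (A u v - (A x y + m * (v - y) + l * (u - x))) <= eta * (t * L)).
    { intros u v Hu Hv. destruct (Hclose u v Hu Hv) as [E1 E2].
      replace (A u v - (A x y + m * (v - y) + l * (u - x))) with
        (A u v - A x y - (l * (u - x) + m * (v - y))) by ring.
      eapply Rle_trans; [apply H1; lra|].
      apply Rmult_le_compat_l; [left; apply cond_pos|]. now apply Rmax_lub. }
    assert (EB : forall u v, a <= u <= b -> c <= v <= d ->
      Rabs (B u v - (B x y + m * (u - x) + n * (v - y))) <= eta * (t * L)).
    { intros u v Hu Hv. destruct (Hclose u v Hu Hv) as [E1 E2].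
      replace (B u v - (B x y + m * (u - x) + n * (v - y))) with
        (B u v - B x y - (m * (u - x) + n * (v - y))) by ring.
      eapply Rle_trans; [apply H2; lra|].
      apply Rmult_le_compat_l; [left; apply cond_pos|]. now apply Rmax_lub. }
    assert (S1 := RInt_near_affine (fun u => A u c) a b (A x y + m * (c - y)) l x (eta * (t * L))).
    assert (S2 := RInt_near_affine (B b) c d (B x y + m * (b - x)) n y (eta * (t * L))).
    assert (S3 := RInt_near_affine (fun u => A u d) a b (A x y + m * (d - y)) l x (eta * (t * L))).
    assert (S4 := RInt_near_affine (B a) c d (B x y + m * (a - x)) n y (eta * (t * L))).
    assert (a <= b) by lra. assert (c <= d) by lra.
    specialize (S1 ltac:(lra) ltac:(apply IA; lra) ltac:(intros; apply EA; lra)).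
    specialize (S2 ltac:(lra) ltac:(apply IB; lra) ltac:(intros; apply EB; lra)).
    specialize (S3 ltac:(lra) ltac:(apply IA; lra) ltac:(intros; apply EA; lra)).
    specialize (S4 ltac:(lra) ltac:(apply IB; lra) ltac:(intros; apply EB; lra)).
    (* The affine parts of the four sides cancel, because the y-derivative of [A] and the
       x-derivative of [B] are the same [m]; only the errors remain. *)
    apply Rle_trans with (2 * ((b - a) + (d - c)) * (eta * (t * L))).
    + unfold boundary_integral.
      apply Rabs_le_between in S1. apply Rabs_le_between in S2.
      apply Rabs_le_between in S3. apply Rabs_le_between in S4.
      apply Rabs_le. lra.
    + replace (b - a) with (al * t) by (unfold b; ring).
      replace (d - c) with (be * t) by (unfold d; ring).
      replace (eps * (t * (t * 1))) with (2 * (t * L) * (eta * (t * L))) by (simpl; field; lra).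
      apply Rmult_le_compat_r.
      * apply Rmult_le_pos; [left; apply cond_pos|]. nra.
      * unfold L. nra. }
apply NNPP. intros Hne. apply Rabs_no_R0 in Hne as Hne'.
pose proof (Rabs_pos (boundary_integral A B a0 b0 c0 d0)).
specialize (Hall (Rabs (boundary_integral A B a0 b0 c0 d0) / 2)). lra.
Qed.

(** Cauchy-Riemann: multiplication by [l] has the real matrix with rows (Re l, - Im l) and (Im l, Re
    l). *)
Lemma cderiv_differentiable (g : C -> C) (z l : C) : cderiv g z l ->
  differentiable_pt_lim (fun x y => Re (g (x, y))) (Re z) (Im z) (Re l) (- Im l) /\
  differentiable_pt_lim (fun x y => Im (g (x, y))) (Re z) (Im z) (Im l) (Re l).
Proof.
intros H.
assert (Hmain : forall eps : posreal, locally_2d (fun u v =>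
   Cmod (g (u, v) - g z - l * ((u, v) - z))%C <= eps * Rmax (Rabs (u - Re z)) (Rabs (v - Im z)))
   (Re z) (Im z)).
{ intros eps. pose proof (cond_pos eps) as He.
  destruct (H (eps / 2)) as [d [Hd H1]]; [lra|].
  assert (Hd2 : 0 < d / 2) by lra. exists (mkposreal _ Hd2). simpl. intros u v Hu Hv.
  assert (HC : Cmod ((u, v) - z)%C <= Rabs (u - Re z) + Rabs (v - Im z)) by exact (Cmod_le_Re_Im ((u, v) - z)%C).
  specialize (H1 ((u, v) - z)%C ltac:(lra)).
  assert (E : @eq C (z + ((u, v) - z))%C (u, v)) by ring. rewrite E in H1.
  generalize (Rmax_l (Rabs (u - Re z)) (Rabs (v - Im z))) (Rmax_r (Rabs (u - Re z)) (Rabs (v - Im z))).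
  intros. apply Rle_trans with (1 := H1). nra. }
destruct z as [x0 y0]; destruct l as [l1 l2]; unfold Re, Im in *; simpl in *.
split; intros eps; destruct (Hmain eps) as [d Hd]; exists d; intros u v Hu Hv;
  specialize (Hd u v Hu Hv); apply Rle_trans with (2 := Hd).
- eapply Rle_trans; [|apply re_le_Cmod]. right. f_equal.
  destruct (g (u, v)); destruct (g (x0, y0)); unfold Re; simpl. ring.
- eapply Rle_trans; [|apply im_le_Cmod]. right. f_equal.
  destruct (g (u, v)); destruct (g (x0, y0)); unfold Im; simpl. ring.
Qed.

(** Products in separated variables are the shape of the polar coordinates [exp x * cos y] and
    [exp x * sin y]. *)
Lemma differentiable_pt_lim_mult_sep (f g : R -> R) x y lf lg :
  derivable_pt_lim f x lf -> derivable_pt_lim g y lg ->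
  differentiable_pt_lim (fun u v => f u * g v) x y (lf * g y) (f x * lg).
Proof.
intros Hf Hg.
assert (Hm : differentiable_pt_lim Rmult (f x) (g y) (g y) (f x)).
{ intros eps. exists eps. intros u v Hu Hv.
  replace (u * v - f x * g y - (g y * (u - f x) + f x * (v - g y))) with
    ((u - f x) * (v - g y)) by ring.
  rewrite Rabs_mult. apply Rmult_le_compat; try apply Rabs_pos; [lra|apply Rmax_r]. }
pose proof (differentiable_pt_lim_comp Rmult (fun u _ => f u) (fun _ v => g v) x y (g y) (f x) lf 0 0 lg Hm) as H.
replace (lf * g y) with (g y * lf + f x * 0) by ring.
replace (f x * lg) with (g y * 0 + f x * lg) by ring.
apply H.
- now apply differentiable_pt_lim_proj1_0.
- intros eps. destruct (differentiable_pt_lim_proj1_0 g y x lg Hg eps) as [d Hd].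
  exists d. intros u v Hu Hv. specialize (Hd v u Hv Hu). simpl in Hd.
  rewrite Rmax_comm. replace (0 * (u - x) + lg * (v - y)) with (lg * (v - y) + 0 * (u - x)) by ring.
  exact Hd.
Qed.

(** * Complex derivatives and the mean value property on circles *)

Lemma RtoC_neq_0 (x : R) : x <> 0 -> RtoC x <> 0%C.
Proof. intros H E. now apply H, RtoC_inj. Qed.

Lemma cderiv_ext_loc (f g : C -> C) (z l : C) d : 0 < d ->
  (forall w, Cmod (w - z)%C < d -> f w = g w) -> cderiv f z l -> cderiv g z l.
Proof.
intros Hd Hfg H eps He. destruct (H eps He) as [d1 [Hd1 H1]].
exists (Rmin d d1). split; [now apply Rmin_pos|]. intros h Hh.
assert (Cmod h < d) by (apply Rlt_le_trans with (1 := Hh); apply Rmin_l).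
assert (Cmod h < d1) by (apply Rlt_le_trans with (1 := Hh); apply Rmin_r).
rewrite <- !Hfg.
- now apply H1.
- replace (z - z)%C with (RtoC 0) by ring. now rewrite Cmod_0.
- now replace (z + h - z)%C with h by ring.
Qed.

Lemma cderiv_ext (f g : C -> C) (z l : C) :
  (forall w, f w = g w) -> cderiv f z l -> cderiv g z l.
Proof. intros H. apply (cderiv_ext_loc f g z l 1); [lra|auto]. Qed.

Lemma cderiv_const (k z : C) : cderiv (fun _ => k) z 0%C.
Proof.
intros eps He. exists 1. split; [lra|]. intros h _.
replace (k - k - 0 * h)%C with (RtoC 0) by ring. rewrite Cmod_0.
apply Rmult_le_pos; [lra|apply Cmod_ge_0].
Qed.

Lemma cderiv_id (z : C) : cderiv (fun w => w) z 1%C.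
Proof.
intros eps He. exists 1. split; [lra|]. intros h _.
replace (z + h - z - 1 * h)%C with (RtoC 0) by ring. rewrite Cmod_0.
apply Rmult_le_pos; [lra|apply Cmod_ge_0].
Qed.

Lemma cderiv_lipschitz (f : C -> C) (z l : C) : cderiv f z l ->
  exists d, 0 < d /\ forall h, Cmod h < d -> Cmod (f (z + h) - f z)%C <= (Cmod l + 1) * Cmod h.
Proof.
intros H. destruct (H 1 Rlt_0_1) as [d [Hd H1]]. exists d. split; trivial.
intros h Hh. specialize (H1 h Hh).
replace (f (z + h) - f z)%C with ((f (z + h) - f z - l * h) + l * h)%C by ring.
eapply Rle_trans; [apply Cmod_triangle|]. rewrite Cmod_mult. lra.
Qed.

Lemma cderiv_continuous (f : C -> C) (z l : C) : cderiv f z l ->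
  forall eps, 0 < eps -> exists d, 0 < d /\ forall w, Cmod (w - z)%C < d -> Cmod (f w - f z)%C < eps.
Proof.
intros H eps He. destruct (cderiv_lipschitz f z l H) as [d [Hd H1]].
pose proof (Cmod_ge_0 l).
assert (H2 : 0 < eps / (Cmod l + 1)) by (apply Rdiv_lt_0_compat; lra).
exists (Rmin d (eps / (Cmod l + 1))). split; [now apply Rmin_pos|].
intros w Hw. specialize (H1 (w - z)%C).
replace (z + (w - z))%C with w in H1 by ring.
assert (Hw1 : Cmod (w - z)%C < d) by (apply Rlt_le_trans with (1 := Hw); apply Rmin_l).
assert (H3 : Cmod (w - z)%C < eps / (Cmod l + 1)) by (apply Rlt_le_trans with (1 := Hw); apply Rmin_r).
apply Rle_lt_trans with (1 := H1 Hw1).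
apply Rmult_lt_compat_l with (r := Cmod l + 1) in H3; [|lra].
now replace ((Cmod l + 1) * (eps / (Cmod l + 1))) with eps in H3 by (field; lra).
Qed.

Lemma cderiv_plus (f g : C -> C) (z l m : C) :
  cderiv f z l -> cderiv g z m -> cderiv (fun w => f w + g w)%C z (l + m)%C.
Proof.
intros Hf Hg eps He.
destruct (Hf (eps / 2)) as [d1 [Hd1 H1]]; [lra|].
destruct (Hg (eps / 2)) as [d2 [Hd2 H2]]; [lra|].
exists (Rmin d1 d2). split; [now apply Rmin_pos|]. intros h Hh.
specialize (H1 h (Rlt_le_trans _ _ _ Hh (Rmin_l _ _))).
specialize (H2 h (Rlt_le_trans _ _ _ Hh (Rmin_r _ _))).
replace (f (z + h) + g (z + h) - (f z + g z) - (l + m) * h)%C with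
  ((f (z + h) - f z - l * h) + (g (z + h) - g z - m * h))%C by ring.
eapply Rle_trans; [apply Cmod_triangle|]. lra.
Qed.

Lemma cderiv_comp (f g : C -> C) (z l m : C) :
  cderiv f z l -> cderiv g (f z) m -> cderiv (fun w => g (f w)) z (m * l)%C.
Proof.
intros Hf Hg eps He.
pose proof (Cmod_ge_0 l) as Hl. pose proof (Cmod_ge_0 m) as Hm.
destruct (cderiv_lipschitz f z l Hf) as [d1 [Hd1 H1]].
destruct (Hg (eps / (2 * (Cmod l + 1)))) as [d2 [Hd2 H2]]; [apply Rdiv_lt_0_compat; lra|].
destruct (Hf (eps / (2 * (Cmod m + 1)))) as [d3 [Hd3 H3]]; [apply Rdiv_lt_0_compat; lra|].
assert (Hd4 : 0 < d2 / (Cmod l + 1)) by (apply Rdiv_lt_0_compat; lra).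
exists (Rmin d1 (Rmin d3 (d2 / (Cmod l + 1)))). split; [repeat apply Rmin_pos; trivial|].
intros h Hh.
assert (K1 : Cmod h < d1) by (apply Rlt_le_trans with (1 := Hh); apply Rmin_l).
assert (K2 : Cmod h < Rmin d3 (d2 / (Cmod l + 1))) by (apply Rlt_le_trans with (1 := Hh); apply Rmin_r).
assert (K3 : Cmod h < d3) by (apply Rlt_le_trans with (1 := K2); apply Rmin_l).
assert (K4 : Cmod h < d2 / (Cmod l + 1)) by (apply Rlt_le_trans with (1 := K2); apply Rmin_r).
specialize (H1 h K1). specialize (H3 h K3).
specialize (H2 (f (z + h) - f z)%C).
replace (f z + (f (z + h) - f z))%C with (f (z + h)%C) in H2 by ring.
apply Rmult_lt_compat_l with (r := Cmod l + 1) in K4; [|lra].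
replace ((Cmod l + 1) * (d2 / (Cmod l + 1))) with d2 in K4 by (field; lra).
specialize (H2 ltac:(lra)).
replace (g (f (z + h)%C) - g (f z) - m * l * h)%C with
  ((g (f (z + h)%C) - g (f z) - m * (f (z + h) - f z)) + m * (f (z + h) - f z - l * h))%C by ring.
eapply Rle_trans; [apply Cmod_triangle|]. rewrite Cmod_mult.
apply Rle_trans with (eps / 2 * Cmod h + eps / 2 * Cmod h); [|lra].
apply Rplus_le_compat.
- apply Rle_trans with (1 := H2).
  replace (eps / 2 * Cmod h) with (eps / (2 * (Cmod l + 1)) * ((Cmod l + 1) * Cmod h)) by (field; lra).
  apply Rmult_le_compat_l; trivial. left; apply Rdiv_lt_0_compat; lra.
- apply Rle_trans with ((Cmod m + 1) * (eps / (2 * (Cmod m + 1)) * Cmod h)); [|right; field; lra].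
  apply Rmult_le_compat; try lra. apply Cmod_ge_0.
Qed.

Lemma cderiv_sqr (z : C) : cderiv (fun w => w * w)%C z (2 * z)%C.
Proof.
intros eps He. exists eps. split; trivial. intros h Hh.
replace ((z + h) * (z + h) - z * z - 2 * z * h)%C with (h * h)%C by ring.
rewrite Cmod_mult. apply Rmult_le_compat_r; [apply Cmod_ge_0|lra].
Qed.

Lemma cderiv_scal (f : C -> C) (k z l : C) : cderiv f z l -> cderiv (fun w => k * f w)%C z (k * l)%C.
Proof.
intros H. apply (cderiv_comp f (fun w => k * w)%C); trivial.
intros eps He. exists 1. split; [lra|]. intros h _.
replace (k * (f z + h) - k * f z - k * h)%C with (RtoC 0) by ring. rewrite Cmod_0.
apply Rmult_le_pos; [lra|apply Cmod_ge_0].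
Qed.

Lemma cderiv_minus (f g : C -> C) (z l m : C) :
  cderiv f z l -> cderiv g z m -> cderiv (fun w => f w - g w)%C z (l - m)%C.
Proof.
intros Hf Hg.
apply cderiv_ext with (fun w => f w + (- (1)) * g w)%C; [intros; ring|].
replace (l - m)%C with (l + (- (1)) * m)%C by ring.
apply cderiv_plus; trivial. now apply cderiv_scal.
Qed.

(* Polarisation [f g = ((f + g)^2 - (f - g)^2) / 4] reduces the product rule
   to the derivative of the square. *)
Lemma cderiv_mult (f g : C -> C) (z l m : C) :
  cderiv f z l -> cderiv g z m ->
  cderiv (fun w => f w * g w)%C z (l * g z + f z * m)%C.
Proof.
intros Hf Hg.
apply cderiv_ext with
  (fun w => / 4 * ((f w + g w) * (f w + g w) - (f w - g w) * (f w - g w)))%C.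
{ intros w. field. }
replace (l * g z + f z * m)%C with
  (/ 4 * (2 * (f z + g z) * (l + m) - 2 * (f z - g z) * (l - m)))%C by field.
apply cderiv_scal. apply cderiv_minus.
- apply (cderiv_comp (fun w => f w + g w)%C (fun w => w * w)%C); [now apply cderiv_plus|apply cderiv_sqr].
- apply (cderiv_comp (fun w => f w - g w)%C (fun w => w * w)%C); [now apply cderiv_minus|apply cderiv_sqr].
Qed.

Lemma cderiv_inv_id (z : C) : z <> 0%C -> cderiv (fun w => / w)%C z (- / (z * z))%C.
Proof.
intros Hz eps He. apply Cmod_gt_0 in Hz as Hz'.
set (r := Cmod z) in *.
(* The remainder is h^2 / (z^2 (z + h)). The first bound gives |z + h| >= r / 2, the second then
   gives |h| <= eps r^2 |z + h|. *)
exists (Rmin (r / 2) (eps * r ^ 3 / 2)). split.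
{ apply Rmin_pos; [lra|]. apply Rdiv_lt_0_compat; [|lra]. apply Rmult_lt_0_compat; trivial. now apply pow_lt. }
intros h Hh.
assert (K1 : Cmod h < r / 2) by (apply Rlt_le_trans with (1 := Hh); apply Rmin_l).
assert (K2 : Cmod h < eps * r ^ 3 / 2) by (apply Rlt_le_trans with (1 := Hh); apply Rmin_r).
assert (K3 : r / 2 <= Cmod (z + h)%C).
{ assert (r <= Cmod (z + h)%C + Cmod h).
  { unfold r. replace z with ((z + h) + - h)%C at 1 by ring.
    rewrite <- (Cmod_opp h). apply Cmod_triangle. }
  lra. }
assert (Hzh : (z + h)%C <> 0%C).
{ intros E. rewrite E, Cmod_0 in K3. lra. }
replace (/ (z + h) - / z - - / (z * z) * h)%C with (h * h / (z * z * (z + h)))%C by (field; auto).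
assert (Hden : (z * z * (z + h))%C <> 0%C) by (repeat apply Cmult_neq_0; trivial).
rewrite Cmod_div, !Cmod_mult by trivial. fold r.
apply Rmult_le_reg_r with (r * r * Cmod (z + h)%C).
{ repeat apply Rmult_lt_0_compat; lra. }
unfold Rdiv. rewrite Rmult_assoc, Rinv_l, Rmult_1_r.
2:{ apply Rgt_not_eq. repeat apply Rmult_lt_0_compat; lra. }
assert (Hp : 0 <= Cmod h) by apply Cmod_ge_0.
replace (eps * Cmod h * (r * r * Cmod (z + h)%C)) with (Cmod h * (eps * (r * r) * Cmod (z + h)%C)) by ring.
apply Rmult_le_compat_l; trivial.
apply Rle_trans with (eps * (r * r) * (r / 2)); [simpl in K2; lra|].
apply Rmult_le_compat_l; trivial. apply Rmult_le_pos; nra.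
Qed.

Lemma cderiv_inv (f : C -> C) (z l : C) : f z <> 0%C -> cderiv f z l ->
  cderiv (fun w => / f w)%C z (- / (f z * f z) * l)%C.
Proof. intros Hz Hf. apply (cderiv_comp f (fun w => / w)%C); trivial. now apply cderiv_inv_id. Qed.

Lemma cderiv_div (f g : C -> C) (z l m : C) : g z <> 0%C -> cderiv f z l -> cderiv g z m ->
  cderiv (fun w => f w / g w)%C z ((l * g z - f z * m) / (g z * g z))%C.
Proof.
intros Hz Hf Hg.
replace ((l * g z - f z * m) / (g z * g z))%C with (l * / g z + f z * (- / (g z * g z) * m))%C
  by (field; trivial).
apply (cderiv_mult f (fun w => / g w)%C); trivial. now apply cderiv_inv.
Qed.

(** The point c + s e^(it), in coordinates so that it agrees by computation with the polar map
    below. *)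
Definition circle_pt (c : C) (s t : R) : C := Cplus c (s * cos t, s * sin t).

Lemma Cmod_circle_pt (c : C) s t : 0 <= s -> Cmod (circle_pt c s t - c)%C = s.
Proof.
intros Hs. assert (E : @eq C (circle_pt c s t - c)%C (s * cos t, s * sin t)) by (unfold circle_pt; ring).
rewrite E.
unfold Cmod; simpl.
replace (s * cos t * (s * cos t * 1) + s * sin t * (s * sin t * 1)) with (s * s * (Rsqr (sin t) + Rsqr (cos t))) by (unfold Rsqr; ring).
rewrite sin2_cos2, Rmult_1_r. now apply sqrt_square.
Qed.

Lemma differentiable_pt_lim_shift (A : R -> R -> R) k x y l m :
  differentiable_pt_lim A x y l m -> differentiable_pt_lim (fun u v => k + A u v) x y l m.
Proof.
intros H eps. destruct (H eps) as [d Hd]. exists d. intros u v Hu Hv.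
replace (k + A u v - (k + A x y)) with (A u v - A x y) by ring. now apply Hd.
Qed.

Lemma ex_RInt_circle (g : C -> C) (c : C) s a b : 0 < s ->
  (forall z, Cmod (z - c)%C = s -> exists l, cderiv g z l) ->
  ex_RInt (fun t => Re (g (circle_pt c s t))) a b.
Proof.
intros Hs Hg. apply (ex_RInt_continuous (V := R_CompleteNormedModule)). intros t _.
destruct (Hg (circle_pt c s t)) as [l Hl]; [apply Cmod_circle_pt; lra|].
destruct (cderiv_differentiable _ _ _ Hl) as [HR _].
pose proof (derivable_pt_lim_comp_2d (fun x y => Re (g (x, y)))
  (fun t => Re c + s * cos t) (fun t => Im c + s * sin t) t (Re l) (- Im l) (s * - sin t) (s * cos t)) as H.
eapply derivable_pt_lim_continuous. apply H.
- exact HR.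
- apply is_derive_Reals. auto_derive; trivial. ring.
- apply is_derive_Reals. auto_derive; trivial. ring.
Qed.

(* In the coordinates [(ln s, t)] the function is [2 pi]-periodic in [t], so the
   vertical sides of the rectangle are the only ones that contribute. *)
Lemma circle_integral_const (g : C -> C) (c : C) (r s1 s2 : R) :
  (forall z, 0 < Cmod (z - c)%C < r -> exists l, cderiv g z l) ->
  0 < s1 <= s2 -> s2 < r ->
  RInt (fun t => Re (g (circle_pt c s1 t))) 0 (2 * PI) =
  RInt (fun t => Re (g (circle_pt c s2 t))) 0 (2 * PI).
Proof.
intros Hg Hs Hr. pose proof PI_RGT_0 as HPI.
pose (G := fun x y : R => g (Re c + exp x * cos y, Im c + exp x * sin y)).
(* [G] is the function g(c + e^zeta) of zeta = x + i y, and Im G dx + Re G dy is the imaginary part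
   of G dzeta. *)
assert (H := closed_form_boundary_integral (fun x y => Im (G x y)) (fun x y => Re (G x y))
  (ln s1) (ln s2) 0 (2 * PI)).
assert (Eper : forall x, G x (2 * PI) = G x 0).
{ intros x. unfold G. now rewrite cos_2PI, sin_2PI, cos_0, sin_0. }
assert (Hexp : forall s t, 0 < s -> G (ln s) t = g (circle_pt c s t)).
{ intros s t Hs'. unfold G. rewrite exp_ln by trivial. reflexivity. }
unfold boundary_integral in H.
rewrite (RInt_ext (fun x => Im (G x (2 * PI))) (fun x => Im (G x 0))) in H
  by (intros; now rewrite Eper).
rewrite (RInt_ext (fun t => Re (g (circle_pt c s1 t))) (fun t => Re (G (ln s1) t)))
  by (intros; rewrite Hexp; [trivial|lra]).
rewrite (RInt_ext (fun t => Re (g (circle_pt c s2 t))) (fun t => Re (G (ln s2) t)))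
  by (intros; rewrite Hexp; [trivial|lra]).
assert (Hln : ln s1 <= ln s2) by (apply ln_le; lra).
cut (RInt (fun x => Im (G x 0)) (ln s1) (ln s2) + RInt (fun t => Re (G (ln s2) t)) 0 (2 * PI)
  - RInt (fun x => Im (G x 0)) (ln s1) (ln s2) - RInt (fun t => Re (G (ln s1) t)) 0 (2 * PI) = 0); [lra|].
apply H; [trivial|lra|].
intros x y Hx _.
set (z := (Re c + exp x * cos y, Im c + exp x * sin y) : C).
assert (Hz : z = circle_pt c (exp x) y) by reflexivity.
destruct (Hg z) as [l Hl].
{ rewrite Hz, Cmod_circle_pt by (left; apply exp_pos). split; [apply exp_pos|].
  apply Rle_lt_trans with (2 := Hr). rewrite <- (exp_ln s2) by lra.
  destruct (proj2 Hx) as [Hlt|Heq]; [left; now apply exp_increasing|rewrite Heq; lra]. }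
destruct (cderiv_differentiable _ _ _ Hl) as [HR HI].
assert (HX : differentiable_pt_lim (fun x y => Re c + exp x * cos y) x y (exp x * cos y) (exp x * - sin y)).
{ apply differentiable_pt_lim_shift. apply differentiable_pt_lim_mult_sep.
  - apply derivable_pt_lim_exp.
  - apply derivable_pt_lim_cos. }
assert (HY : differentiable_pt_lim (fun x y => Im c + exp x * sin y) x y (exp x * sin y) (exp x * cos y)).
{ apply differentiable_pt_lim_shift. apply differentiable_pt_lim_mult_sep.
  - apply derivable_pt_lim_exp.
  - apply derivable_pt_lim_sin. }
exists (Im l * (exp x * cos y) + Re l * (exp x * sin y)).
exists (Im l * (exp x * - sin y) + Re l * (exp x * cos y)).
exists (Re l * (exp x * - sin y) + - Im l * (exp x * cos y)).
split.
- apply (differentiable_pt_lim_comp (fun u v => Im (g (u, v)))); trivial.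
(* The y-derivative of Im G equals the x-derivative of Re G: this is the closedness of the form. *)
- replace (Im l * (exp x * - sin y) + Re l * (exp x * cos y)) with
    (Re l * (exp x * cos y) + - Im l * (exp x * sin y)) by ring.
  apply (differentiable_pt_lim_comp (fun u v => Re (g (u, v)))); trivial.
Qed.

(** Circle averages do not depend on the radius, hence equal their limit at radius 0. Asking only
    for a limit [L] at the centre makes this applicable to difference quotients, whose value at the
    centre is meaningless. *)
Lemma circle_mean_value (g : C -> C) (c L : C) (r s : R) :
  (forall z, 0 < Cmod (z - c)%C < r -> exists l, cderiv g z l) ->
  (forall eps, 0 < eps -> exists d, 0 < d /\
     forall z, 0 < Cmod (z - c)%C < d -> Cmod (g z - L)%C <= eps) ->
  0 < s < r ->
  RInt (fun t => Re (g (circle_pt c s t))) 0 (2 * PI) = 2 * PI * Re L.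
Proof.
intros Hg HL Hs. pose proof PI_RGT_0 as HPI.
assert (Hall : forall eps, 0 < eps ->
  Rabs (RInt (fun t => Re (g (circle_pt c s t))) 0 (2 * PI) - 2 * PI * Re L) <= 2 * PI * eps).
{ intros eps He. destruct (HL eps He) as [d [Hd H]].
  assert (Hm : 0 < Rmin s (d / 2)) by (apply Rmin_pos; lra).
  assert (Hm1 : Rmin s (d / 2) <= s) by apply Rmin_l.
  assert (Hm2 : Rmin s (d / 2) <= d / 2) by apply Rmin_r.
  rewrite <- (circle_integral_const g c r (Rmin s (d / 2)) s); trivial; try lra.
  pose proof (RInt_near_affine (fun t => Re (g (circle_pt c (Rmin s (d / 2)) t)))
     0 (2 * PI) (Re L) 0 0 eps) as K.
  replace (Re L * (2 * PI - 0) + 0 * ((2 * PI - 0) ^ 2 - (0 - 0) ^ 2) / 2) with (2 * PI * Re L) in K by field.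
  rewrite Rminus_0_r in K. apply K; [lra| |].
  - apply ex_RInt_circle; trivial. intros z Hz. apply Hg. lra.
  - intros t _. replace (Re L + 0 * (t - 0)) with (Re L) by ring.
    eapply Rle_trans; [|apply (H (circle_pt c (Rmin s (d / 2)) t))].
    + eapply Rle_trans; [|apply re_le_Cmod]. right. f_equal.
    + rewrite Cmod_circle_pt; lra. }
apply NNPP. intros Hne.
assert (Hne' : RInt (fun t => Re (g (circle_pt c s t))) 0 (2 * PI) - 2 * PI * Re L <> 0) by lra.
apply Rabs_pos_lt in Hne'.
set (X := Rabs (RInt (fun t => Re (g (circle_pt c s t))) 0 (2 * PI) - 2 * PI * Re L)) in *.
specialize (Hall (X / (4 * PI)) ltac:(apply Rdiv_lt_0_compat; lra)).
replace (2 * PI * (X / (4 * PI))) with (X / 2) in Hall by (field; lra). lra.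
Qed.

(** * Cauchy's estimate and the derivative of a derivative *)

Lemma cderiv_C_derive (f : C -> C) (z : C) :
  (exists l, cderiv f z l) -> cderiv f z (C_derive f z).
Proof. intros [l Hl]. now rewrite (C_derive_cderiv f z l Hl). Qed.

(** Averages and derivatives are controlled through real parts; rotating by [u] recovers the
    modulus. *)
Lemma exists_rotation (l : C) : exists u : C, Cmod u = 1 /\ Re (u * l)%C = Cmod l.
Proof.
destruct (Ceq_dec l 0%C) as [->|Hl].
- exists 1%C. split; [apply Cmod_1|]. rewrite Cmult_0_r, Cmod_0. reflexivity.
- apply Cmod_gt_0 in Hl as Hl'. exists (Cconj l / Cmod l)%C.
  assert (Hn : RtoC (Cmod l) <> 0%C) by (apply RtoC_neq_0; lra).
  split.
  + rewrite Cmod_div, Cmod_conj, Cmod_R, Rabs_pos_eq by (trivial; lra). field; lra.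
  + replace (Cconj l / Cmod l * l)%C with (l * Cconj l / Cmod l)%C by (field; trivial).
    rewrite <- Cmod2_conj, <- RtoC_div by lra. rewrite re_RtoC. field; lra.
Qed.

Lemma Re_le_Cmod (z : C) : Re z <= Cmod z.
Proof. apply Rle_trans with (2 := re_le_Cmod z). apply Rle_abs. Qed.

(** The quotient (f z - f c) / (z - c) tends to [l] at [c], so [l] is its average over the circle of
    radius r / 2, where its modulus is at most 2 M / (r / 2). This is the origin of the 4. *)
Lemma cauchy_estimate (f : C -> C) (c l : C) r M : 0 < r ->
  (forall z, Cmod (z - c)%C < r -> exists l, cderiv f z l) ->
  (forall z, Cmod (z - c)%C < r -> Cmod (f z) <= M) ->
  cderiv f c l -> Cmod l <= 4 * M / r.
Proof.
intros Hr Hf HM Hl. pose proof PI_RGT_0 as HPI.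
destruct (exists_rotation l) as [u [Hu1 Hu2]].
assert (Hdiff : forall z, 0 < Cmod (z - c)%C -> (z - c)%C <> 0%C).
{ intros z Hz. now apply Cmod_gt_0. }
pose (g := fun z => (u * ((f z - f c) / (z - c)))%C).
assert (Hg : forall z, 0 < Cmod (z - c)%C < r -> exists l, cderiv g z l).
{ intros z [Hz1 Hz2]. destruct (Hf z Hz2) as [m Hm]. eexists. unfold g. apply cderiv_scal.
  apply (cderiv_div (fun z => f z - f c)%C (fun z => z - c)%C); [now apply Hdiff| |].
  - apply cderiv_minus; [exact Hm|apply cderiv_const].
  - apply cderiv_minus; [apply cderiv_id|apply cderiv_const]. }
assert (Hmv := circle_mean_value g c (u * l)%C r (r / 2) Hg).
rewrite Hu2 in Hmv.
assert (Hc : Cmod (f c) <= M).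
{ apply HM. replace (c - c)%C with (RtoC 0) by ring. rewrite Cmod_0; trivial. }
assert (Hle : RInt (fun t => Re (g (circle_pt c (r / 2) t))) 0 (2 * PI) <= (2 * PI - 0) * (4 * M / r)).
{ eapply Rle_trans; [apply Rle_abs|].
  apply abs_RInt_le_const; [lra| |].
  { apply ex_RInt_circle; [lra|]. intros z Hz. apply Hg. lra. }
  intros t _. apply Rle_trans with (1 := re_le_Cmod _).
  assert (E : Cmod (circle_pt c (r / 2) t - c)%C = r / 2) by (apply Cmod_circle_pt; lra).
  unfold g. rewrite Cmod_mult, Hu1, Rmult_1_l, Cmod_div, E by (apply Hdiff; lra).
  replace (4 * M / r) with ((M + M) / (r / 2)) by (field; lra).
  apply Rmult_le_compat_r; [left; apply Rinv_0_lt_compat; lra|].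
  unfold Cminus. eapply Rle_trans; [apply Cmod_triangle|]. rewrite Cmod_opp.
  apply Rplus_le_compat; trivial. apply HM. lra. }
rewrite Hmv in Hle; [|clear Hle|lra].
- apply Rmult_le_reg_l with (2 * PI); lra.
- intros eps He. destruct (Hl eps He) as [d [Hd H]]. exists d. split; trivial.
  intros z [Hz1 Hz2]. specialize (H (z - c)%C Hz2).
  replace (c + (z - c))%C with z in H by ring.
  unfold g.
  replace (u * ((f z - f c) / (z - c)) - u * l)%C with (u * ((f z - f c - l * (z - c)) / (z - c)))%C
    by (field; auto).
  rewrite Cmod_mult, Hu1, Rmult_1_l, Cmod_div by auto.
  apply Rmult_le_reg_r with (Cmod (z - c)%C); trivial.
  unfold Rdiv. rewrite Rmult_assoc, Rinv_l, Rmult_1_r by lra. exact H.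
Qed.

Lemma cderiv_line (f : C -> C) (w v : C) (t : R) (l : C) : cderiv f (w + t * v)%C l ->
  derivable_pt_lim (fun s : R => Re (f (w + s * v)%C)) t (Re (l * v)%C) /\
  derivable_pt_lim (fun s : R => Im (f (w + s * v)%C)) t (Im (l * v)%C).
Proof.
intros Hl. destruct (cderiv_differentiable _ _ _ Hl) as [HR HI].
assert (Ep : forall s : R, (w + s * v)%C = (Re w + s * Re v, Im w + s * Im v)).
{ intros s. destruct w as [w1 w2], v as [v1 v2]. unfold Re, Im; simpl.
  unfold Cplus, Cmult, RtoC; simpl. f_equal; ring. }
rewrite Ep in HR, HI.
assert (Hx : derivable_pt_lim (fun s => Re w + s * Re v) t (Re v)).
{ apply is_derive_Reals. auto_derive; trivial. ring. }
assert (Hy : derivable_pt_lim (fun s => Im w + s * Im v) t (Im v)).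
{ apply is_derive_Reals. auto_derive; trivial. ring. }
assert (Hext : forall (pr : C -> R) a,
  derivable_pt_lim (fun s => pr (f (Re w + s * Re v, Im w + s * Im v))) t a ->
  derivable_pt_lim (fun s : R => pr (f (w + s * v)%C)) t a).
{ intros pr a H. apply is_derive_Reals. apply is_derive_Reals in H. revert H.
  apply is_derive_ext. intros s. now rewrite Ep. }
split; apply Hext.
- replace (Re (l * v)%C) with (Re l * Re v + - Im l * Im v) by (rewrite re_mult; ring).
  apply (derivable_pt_lim_comp_2d (fun x y => Re (f (x, y)))); trivial.
- replace (Im (l * v)%C) with (Im l * Re v + Re l * Im v) by (rewrite im_mult; ring).
  apply (derivable_pt_lim_comp_2d (fun x y => Im (f (x, y)))); trivial.
Qed.

(** After a rotation that makes the increment of [f] real and nonnegative, the real mean value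
    theorem applies to the real part along the segment. *)
Lemma mean_value_inequality (f : C -> C) (w z : C) L :
  (forall t : R, 0 <= t <= 1 -> exists l, cderiv f (w + t * (z - w))%C l /\ Cmod l <= L) ->
  Cmod (f z - f w)%C <= L * Cmod (z - w)%C.
Proof.
intros Hf. destruct (exists_rotation (f z - f w)%C) as [u [Hu1 Hu2]].
pose (p := fun t : R => (w + t * (z - w))%C).
pose (phi := fun t : R => Re (u * f (p t))%C).
assert (Hphi : forall t, 0 <= t <= 1 ->
  is_derive phi t (Re (u * C_derive f (p t) * (z - w))%C)).
{ intros t Ht. destruct (Hf t Ht) as [l [Hl _]]. fold (p t) in Hl.
  rewrite (C_derive_cderiv _ _ _ Hl). apply is_derive_Reals.
  apply (cderiv_line (fun z => u * f z)%C w (z - w)%C t). now apply cderiv_scal. }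
destruct (MVT_gen phi 0 1 (fun t => Re (u * C_derive f (p t) * (z - w))%C)) as [t [Ht E]].
- rewrite Rmin_left, Rmax_right by lra. intros x Hx. apply Hphi. lra.
- rewrite Rmin_left, Rmax_right by lra. intros x Hx.
  apply continuity_pt_filterlim.
  apply (ex_derive_continuous (K := R_AbsRing) (V := R_NormedModule)).
  eexists. apply Hphi. lra.
- rewrite Rmin_left, Rmax_right in Ht by lra.
  destruct (Hf t Ht) as [l [Hl HlL]]. fold (p t) in Hl.
  rewrite (C_derive_cderiv _ _ _ Hl) in E.
  assert (E0 : p 0 = w) by (unfold p; ring). assert (E1 : p 1 = z) by (unfold p; ring).
  rewrite <- Hu2.
  replace (Re (u * (f z - f w))%C) with (phi 1 - phi 0).
  2:{ unfold phi. rewrite E0, E1. replace (u * (f z - f w))%C with (u * f z + - (u * f w))%C by ring.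
      rewrite re_plus, re_opp. ring. }
  rewrite E, Rminus_0_r, Rmult_1_r. apply Rle_trans with (1 := Re_le_Cmod _).
  rewrite !Cmod_mult, Hu1, Rmult_1_l. apply Rmult_le_compat_r; trivial. apply Cmod_ge_0.
Qed.

Lemma ball_segment (c w z : C) r (t : R) : Cmod (w - c)%C < r -> Cmod (z - c)%C < r ->
  0 <= t <= 1 -> Cmod (w + t * (z - w) - c)%C < r.
Proof.
intros Hw Hz Ht.
replace (w + t * (z - w) - c)%C with ((1 - t)%R * (w - c) + t * (z - c))%C
  by (rewrite RtoC_minus; ring).
eapply Rle_lt_trans; [apply Cmod_triangle|].
rewrite !Cmod_mult, !Cmod_R, !Rabs_pos_eq by lra.
destruct (Req_dec t 0) as [->|Hne]; nra.
Qed.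

Lemma ball_mean_value_inequality (f : C -> C) (c w z : C) r L :
  (forall z, Cmod (z - c)%C < r -> exists l, cderiv f z l /\ Cmod l <= L) ->
  Cmod (w - c)%C < r -> Cmod (z - c)%C < r -> Cmod (f z - f w)%C <= L * Cmod (z - w)%C.
Proof.
intros Hf Hw Hz. apply mean_value_inequality. intros t Ht. apply Hf. now apply ball_segment.
Qed.

(** A Cauchy criterion without sequences: the intervals of centre q h and radius K |h| meet
    pairwise, so the supremum of their left endpoints lies in all of them. *)
Lemma exists_limit_at_zero_R (P : C -> Prop) (q : C -> R) K :
  (exists h, P h) ->
  (forall h k, P h -> P k -> Rabs (q h - q k) <= K * (Cmod h + Cmod k)) ->
  exists x, forall h, P h -> Rabs (q h - x) <= K * Cmod h.
Proof.
intros [h0 Hh0] H.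
destruct (completeness (fun x => exists k, P k /\ x = q k - K * Cmod k)) as [x [Hx1 Hx2]].
- exists (q h0 + K * Cmod h0). intros y (k & Hk & ->).
  specialize (H k h0 Hk Hh0). apply Rabs_le_between in H. lra.
- exists (q h0 - K * Cmod h0). now exists h0.
- exists x. intros h Hh. apply Rabs_le. split.
  + cut (x <= q h + K * Cmod h); [lra|]. apply Hx2. intros y (k & Hk & ->).
    specialize (H k h Hk Hh). apply Rabs_le_between in H. lra.
  + cut (q h - K * Cmod h <= x); [lra|]. apply Hx1. now exists h.
Qed.

Lemma exists_limit_at_zero (q : C -> C) K d : 0 < d ->
  (forall h k, 0 < Cmod h < d -> 0 < Cmod k < d -> Cmod (q h - q k)%C <= K * (Cmod h + Cmod k)) ->
  exists m, forall h, 0 < Cmod h < d -> Cmod (q h - m)%C <= 2 * K * Cmod h.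
Proof.
intros Hd H.
assert (Hex : exists h, 0 < Cmod h < d).
{ exists (RtoC (d / 2)). rewrite Cmod_R, Rabs_pos_eq; lra. }
destruct (exists_limit_at_zero_R (fun h => 0 < Cmod h < d) (fun h => Re (q h)) K Hex) as [x Hx].
{ intros h k Hh Hk. apply Rle_trans with (2 := H h k Hh Hk).
  eapply Rle_trans; [|apply re_le_Cmod]. right. f_equal. }
destruct (exists_limit_at_zero_R (fun h => 0 < Cmod h < d) (fun h => Im (q h)) K Hex) as [y Hy].
{ intros h k Hh Hk. apply Rle_trans with (2 := H h k Hh Hk).
  eapply Rle_trans; [|apply im_le_Cmod]. right. f_equal. }
exists (x, y). intros h Hh. eapply Rle_trans; [apply Cmod_le_Re_Im|].
specialize (Hx h Hh). specialize (Hy h Hh).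
change (Rabs (Re (q h) - x) + Rabs (Im (q h) - y) <= 2 * K * Cmod h). lra.
Qed.

(* The difference quotients [D_h] of [f] converge uniformly to [f'] at rate
   [O(|h|)], so the Cauchy estimate makes their derivatives at [c] Cauchy. *)
Lemma C_derive_differentiable (f : C -> C) (c : C) r : 0 < r ->
  (forall z, Cmod (z - c)%C < r -> exists l, cderiv f z l) ->
  exists m, cderiv (C_derive f) c m.
Proof.
intros Hr Hf.
assert (H0 : Cmod (c - c)%C = 0) by (replace (c - c)%C with (RtoC 0) by ring; apply Cmod_0).
destruct (Hf c ltac:(lra)) as [l Hl].
destruct (cderiv_continuous f c l Hl 1 Rlt_0_1) as [d [Hd Hcont]].
(* On radius [rho] the function is bounded by [M]. The later radii rho / 2, rho / 8, rho / 16 keep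
   every shifted point z + h inside a disc where the previous bound holds. *)
set (rho := Rmin r d). assert (Hrho : 0 < rho) by now apply Rmin_pos.
assert (Hrr : rho <= r) by apply Rmin_l. assert (Hrd : rho <= d) by apply Rmin_r. clearbody rho.
assert (Hf1 : forall z, Cmod (z - c)%C < rho -> cderiv f z (C_derive f z)).
{ intros z Hz. apply cderiv_C_derive, Hf. lra. }
set (M := Cmod (f c) + 1).
assert (HM : forall z, Cmod (z - c)%C < rho -> Cmod (f z) <= M).
{ intros z Hz. specialize (Hcont z ltac:(lra)). unfold M.
  replace (f z) with (f c + (f z - f c))%C by ring.
  eapply Rle_trans; [apply Cmod_triangle|]. lra. }
assert (tri : forall a b, Cmod (a - c)%C < b -> forall h e, Cmod (h - a)%C < e -> Cmod (h - c)%C < b + e).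
{ intros a b Ha h e Hh. replace (h - c)%C with ((h - a) + (a - c))%C by ring.
  eapply Rle_lt_trans; [apply Cmod_triangle|]. lra. }
assert (trih : forall a b, Cmod (a - c)%C < b -> forall h e, Cmod h < e -> Cmod (a + h - c)%C < b + e).
{ intros a b Ha h e Hh. apply (tri a b Ha). now replace (a + h - a)%C with h by ring. }
set (L1 := 4 * M / (rho / 2)).
assert (HL1 : forall z, Cmod (z - c)%C < rho / 2 -> Cmod (C_derive f z) <= L1).
{ intros z Hz. apply (cauchy_estimate f z); [lra| | |apply Hf1; lra].
  - intros w Hw. apply Hf. pose proof (tri _ _ Hz _ _ Hw). lra.
  - intros w Hw. apply HM. pose proof (tri _ _ Hz _ _ Hw). lra. }
assert (Hlip : forall w z, Cmod (w - c)%C < rho / 2 -> Cmod (z - c)%C < rho / 2 ->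
  Cmod (f z - f w)%C <= L1 * Cmod (z - w)%C).
{ intros w z Hw Hz. apply ball_mean_value_inequality with c (rho / 2); trivial.
  intros y Hy. exists (C_derive f y). split; [apply Hf1; lra|now apply HL1]. }
assert (Hshift : forall z h, Cmod (z + h - c)%C < rho ->
   cderiv (fun w => f (w + h)%C) z (C_derive f (z + h)%C)).
{ intros z h Hz. replace (C_derive f (z + h)%C) with (C_derive f (z + h)%C * (1 + 0))%C by ring.
  apply (cderiv_comp (fun w => w + h)%C f).
  - apply cderiv_plus; [apply cderiv_id|apply cderiv_const].
  - now apply Hf1. }
(* A Lipschitz constant for f': Cauchy's estimate on radius rho / 8 for f(w + h) - f(w), which is at
   most L1 |h|. *)
set (L2 := 4 * L1 / (rho / 8)).
assert (HL2 : forall z h, Cmod (z - c)%C < rho / 8 -> Cmod h < rho / 4 ->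
  Cmod (C_derive f (z + h) - C_derive f z)%C <= L2 * Cmod h).
{ intros z h Hz Hh.
  replace (L2 * Cmod h) with (4 * (L1 * Cmod h) / (rho / 8)) by (unfold L2; field; lra).
  apply (cauchy_estimate (fun w => f (w + h) - f w)%C z); [lra| | |].
  - intros w Hw. pose proof (tri _ _ Hz _ _ Hw) as Hw'. pose proof (trih _ _ Hw' _ _ Hh).
    eexists. apply cderiv_minus; [apply Hshift; lra|apply Hf1; lra].
  - intros w Hw. pose proof (tri _ _ Hz _ _ Hw) as Hw'. pose proof (trih _ _ Hw' _ _ Hh).
    replace (Cmod h) with (Cmod (w + h - w)%C) by (f_equal; ring). apply Hlip; lra.
  - pose proof (trih _ _ Hz _ _ Hh). apply cderiv_minus; [apply Hshift; lra|apply Hf1; lra]. }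
assert (HL2pos : 0 <= L2).
{ specialize (HL2 c (RtoC (rho / 8)) ltac:(lra)).
  rewrite Cmod_R, Rabs_pos_eq in HL2 by lra. specialize (HL2 ltac:(lra)).
  pose proof (Cmod_ge_0 (C_derive f (c + (rho / 8)%R) - C_derive f c)%C).
  apply Rmult_le_reg_r with (rho / 8); lra. }
pose (Dq := fun h z => ((f (z + h) - f z) / h)%C).
assert (HD : forall z h, Cmod (z - c)%C < rho / 16 -> 0 < Cmod h < rho / 16 ->
  Cmod (Dq h z - C_derive f z)%C <= L2 * Cmod h).
{ intros z h Hz [Hh1 Hh2]. apply Cmod_gt_0 in Hh1 as Hh0.
  unfold Dq.
  replace ((f (z + h) - f z) / h - C_derive f z)%C with
    (((f (z + h) - C_derive f z * (z + h)) - (f z - C_derive f z * z)) / h)%C by (field; trivial).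
  rewrite Cmod_div by trivial.
  apply Rmult_le_reg_r with (Cmod h); trivial.
  unfold Rdiv. rewrite Rmult_assoc, Rinv_l, Rmult_1_r by lra.
  replace (L2 * Cmod h * Cmod h) with (L2 * Cmod h * Cmod (z + h - z)%C).
  2:{ do 2 f_equal. ring. }
  (* Subtracting the tangent leaves the derivative f'(w) - f'(z), of modulus at most L2 |h| on the
     segment from z to z + h. *)
  apply (mean_value_inequality (fun w => f w - C_derive f z * w)%C).
  intros t Ht.
  assert (Hth : Cmod (t * h)%C <= Cmod h).
  { rewrite Cmod_mult, Cmod_R, Rabs_pos_eq by lra. nra. }
  replace (z + t * (z + h - z))%C with (z + t * h)%C by ring.
  exists (C_derive f (z + t * h) - C_derive f z * 1)%C. split.
  - apply cderiv_minus; [|apply cderiv_scal, cderiv_id].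
    apply Hf1. pose proof (trih _ _ Hz (t * h)%C (rho / 16)). lra.
  - rewrite Cmult_1_r. apply Rle_trans with (L2 * Cmod (t * h)%C); [apply HL2; lra|].
    now apply Rmult_le_compat_l. }
destruct (exists_limit_at_zero (fun h => (C_derive f (c + h) - C_derive f c) / h)%C
   (4 * L2 / (rho / 16)) (rho / 16)) as [m Hm]; [lra| |].
{ intros h k Hh Hk.
  assert (Hh0 : h <> 0%C) by (apply Cmod_gt_0; lra).
  assert (Hk0 : k <> 0%C) by (apply Cmod_gt_0; lra).
  replace (4 * L2 / (rho / 16) * (Cmod h + Cmod k)) with
    (4 * (L2 * Cmod h + L2 * Cmod k) / (rho / 16)) by (field; lra).
  assert (HDq : forall h z : C, h <> 0%C -> Cmod (z - c)%C < rho / 16 -> Cmod h < rho / 16 ->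
    cderiv (Dq h) z ((C_derive f (z + h) - C_derive f z) / h)%C).
  { intros h' z Hh' Hz Hhr. unfold Dq.
    apply cderiv_ext with (fun w => / h' * (f (w + h') - f w))%C; [intros; field; trivial|].
    replace ((C_derive f (z + h') - C_derive f z) / h')%C with
      (/ h' * (C_derive f (z + h') - C_derive f z))%C by (field; trivial).
    apply cderiv_scal. pose proof (trih _ _ Hz _ _ Hhr).
    apply cderiv_minus; [apply Hshift; lra|apply Hf1; lra]. }
  (* Both quotients are close to f', so their difference is at most L2 (|h| + |k|) on radius rho /
     16; its derivative at [c] is the difference of the difference quotients of f'. *)
  apply (cauchy_estimate (fun z => Dq h z - Dq k z)%C c); [lra| | |].
  - intros z Hz. eexists. apply cderiv_minus; apply HDq; trivial; lra.
  - intros z Hz.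
    replace (Dq h z - Dq k z)%C with ((Dq h z - C_derive f z) + - (Dq k z - C_derive f z))%C by ring.
    eapply Rle_trans; [apply Cmod_triangle|]. rewrite Cmod_opp.
    apply Rplus_le_compat; now apply HD.
  - apply cderiv_minus; apply HDq; trivial; lra. }
exists m. intros eps He.
set (K := 2 * (4 * L2 / (rho / 16))) in *.
assert (HK : 0 <= K).
{ unfold K. apply Rmult_le_pos; [lra|]. apply Rmult_le_pos; [lra|]. left; apply Rinv_0_lt_compat; lra. }
exists (Rmin (rho / 16) (eps / (K + 1))). split.
{ apply Rmin_pos; [lra|]. apply Rdiv_lt_0_compat; lra. }
intros h Hh.
destruct (Ceq_dec h 0%C) as [->|Hh0].
{ replace (C_derive f (c + 0) - C_derive f c - m * 0)%C with (RtoC 0).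
  - rewrite Cmod_0. lra.
  - replace (c + 0)%C with c by ring. ring. }
apply Cmod_gt_0 in Hh0 as Hh1.
assert (K1 : Cmod h < rho / 16) by (apply Rlt_le_trans with (1 := Hh); apply Rmin_l).
assert (K2 : Cmod h < eps / (K + 1)) by (apply Rlt_le_trans with (1 := Hh); apply Rmin_r).
specialize (Hm h (conj Hh1 K1)).
replace (C_derive f (c + h) - C_derive f c - m * h)%C with
  (((C_derive f (c + h) - C_derive f c) / h - m) * h)%C by (field; trivial).
rewrite Cmod_mult. apply Rmult_le_compat_r; [lra|].
apply Rle_trans with (1 := Hm).
apply Rmult_lt_compat_l with (r := K + 1) in K2; [|lra].
replace ((K + 1) * (eps / (K + 1))) with eps in K2 by (field; lra). nra.
Qed.

(** * Maximum modulus and Schwarz's lemma *)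

Lemma Cminus_0_r (z : C) : (z - 0)%C = z.
Proof. ring. Qed.

(** With f(0) = 0 and [a] the derivative of [f] at 0, this is the holomorphic extension of f(z) /
    z. *)
Definition quot (f : C -> C) (a : C) (z : C) : C :=
  if Ceq_dec z 0%C then a else (f z / z)%C.

Lemma quot_0 f a : quot f a 0%C = a.
Proof. unfold quot. destruct (Ceq_dec 0 0) as [_|H]; [trivial|now elim H]. Qed.

Lemma quot_neq_0 f a (z : C) : z <> 0%C -> quot f a z = (f z / z)%C.
Proof. intros Hz. unfold quot. destruct (Ceq_dec z 0) as [H|_]; [now elim Hz|trivial]. Qed.

Lemma cderiv_quot_neq_0 (f : C -> C) (a z l : C) : z <> 0%C -> cderiv f z l ->
  cderiv (quot f a) z ((l * z - f z) / (z * z))%C.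
Proof.
intros Hz Hf. apply cderiv_ext_loc with (fun w => f w / w)%C (Cmod z).
- now apply Cmod_gt_0.
- intros w Hw. symmetry. apply quot_neq_0. intros ->.
  replace (0 - z)%C with (- z)%C in Hw by ring. rewrite Cmod_opp in Hw. lra.
- replace (l * z - f z)%C with (l * z - f z * 1)%C by ring.
  apply (cderiv_div f (fun w => w)); trivial. apply cderiv_id.
Qed.

Lemma quot_continuous_0 (f : C -> C) (a : C) : f 0%C = 0%C -> cderiv f 0%C a ->
  forall eps, 0 < eps -> exists d, 0 < d /\
    forall z, Cmod z < d -> Cmod (quot f a z - a)%C <= eps.
Proof.
intros Hf0 Hf eps He. destruct (Hf eps He) as [d [Hd H]]. exists d. split; trivial.
intros z Hz. destruct (Ceq_dec z 0%C) as [->|Hz0].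
- rewrite quot_0. replace (a - a)%C with (RtoC 0) by ring. rewrite Cmod_0. lra.
- specialize (H z Hz). rewrite Hf0, Cplus_0_l, Cminus_0_r in H.
  rewrite quot_neq_0 by trivial.
  replace (f z / z - a)%C with ((f z - a * z) / z)%C by (field; trivial).
  apply Cmod_gt_0 in Hz0 as Hz1. rewrite Cmod_div by trivial.
  apply Rmult_le_reg_r with (Cmod z); trivial.
  unfold Rdiv. rewrite Rmult_assoc, Rinv_l, Rmult_1_r by lra. exact H.
Qed.

(** Second-order Taylor expansion: [rem] has derivative f'(w) - a - b w = o(|w|), so it is o(|h|^2)
    by the mean value inequality; then divide by h. *)
Lemma cderiv_quot_0 (f : C -> C) (b : C) r : 0 < r -> f 0%C = 0%C ->
  (forall z, Cmod z < r -> exists l, cderiv f z l) ->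
  cderiv (C_derive f) 0%C b ->
  cderiv (quot f (C_derive f 0%C)) 0%C (b / 2)%C.
Proof.
intros Hr Hf0 Hf Hb eps He. set (a := C_derive f 0%C) in *.
destruct (Hb eps He) as [d [Hd H]].
exists (Rmin r d). split; [now apply Rmin_pos|]. intros h Hh.
assert (K1 : Cmod h < r) by (apply Rlt_le_trans with (1 := Hh); apply Rmin_l).
assert (K2 : Cmod h < d) by (apply Rlt_le_trans with (1 := Hh); apply Rmin_r).
rewrite quot_0, Cplus_0_l.
destruct (Ceq_dec h 0%C) as [->|Hh0].
{ rewrite quot_0. replace (a - a - b / 2 * 0)%C with (RtoC 0) by (field).
  rewrite Cmod_0. lra. }
apply Cmod_gt_0 in Hh0 as Hh1.
rewrite quot_neq_0 by trivial.
pose (rem := fun w => (f w - (a * w + b / 2 * (w * w)))%C).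
assert (Hrem : Cmod (rem h - rem 0%C)%C <= eps * Cmod h * Cmod (h - 0)%C).
{ apply mean_value_inequality. intros t Ht.
  replace (0 + t * (h - 0))%C with (t * h)%C by ring.
  assert (Hth : Cmod (t * h)%C <= Cmod h).
  { rewrite Cmod_mult, Cmod_R, Rabs_pos_eq by lra. nra. }
  exists (C_derive f (t * h) - (a * 1 + b / 2 * (2 * (t * h))))%C. split.
  - apply cderiv_minus.
    + apply cderiv_C_derive, Hf. lra.
    + apply cderiv_plus; [apply cderiv_scal, cderiv_id|apply cderiv_scal, cderiv_sqr].
  - replace (C_derive f (t * h) - (a * 1 + b / 2 * (2 * (t * h))))%C with
     (C_derive f (0 + t * h) - a - b * (t * h))%C.
    2:{ rewrite Cplus_0_l. field. }
    eapply Rle_trans; [apply H; lra|]. apply Rmult_le_compat_l; lra. }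
replace (rem h - rem 0%C)%C with ((f h / h - a - b / 2 * h) * h)%C in Hrem
  by (unfold rem; rewrite Hf0; field; trivial).
rewrite Cminus_0_r, Cmod_mult in Hrem.
now apply Rmult_le_reg_r with (Cmod h).
Qed.

(** On a circle around [w] the first two terms are constant and the last is the real part of a
    function holomorphic in [z], which averages to its value at [w]. *)
Lemma Cmod_sqr_shift (z w : C) :
  Cmod z ^ 2 = Cmod w ^ 2 + Cmod (z - w)%C ^ 2 + 2 * Re (Cconj w * (z - w))%C.
Proof.
rewrite !Cmod2_alt. unfold Cminus. rewrite re_mult, !re_plus, !im_plus, !re_opp, !im_opp, re_conj, im_conj.
ring.
Qed.

Lemma closed_disc_complement (rho : R) (z : C) : ~ Cmod z <= rho ->
  exists d, 0 < d /\ forall w, Cmod (w - z)%C < d -> ~ Cmod w <= rho.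
Proof.
intros Hz. exists (Cmod z - rho). split; [lra|]. intros w Hw Hwr.
assert (Cmod z <= Cmod w + Cmod (w - z)%C); [|lra].
replace z with (w + - (w - z))%C at 1 by ring.
rewrite <- (Cmod_opp (w - z)%C). apply Cmod_triangle.
Qed.

Lemma Cmod_Cmod_minus (z w : C) : Rabs (Cmod z - Cmod w) <= Cmod (z - w)%C.
Proof.
apply Rabs_le. split.
- cut (Cmod w <= Cmod z + Cmod (z - w)%C); [lra|].
  replace w with (z + - (z - w))%C at 1 by ring.
  rewrite <- (Cmod_opp (z - w)%C). apply Cmod_triangle.
- cut (Cmod z <= Cmod w + Cmod (z - w)%C); [lra|].
  replace z with (w + (z - w))%C at 1 by ring. apply Cmod_triangle.
Qed.

(* Adding [eps |z|^2] makes [|g|] strictly subharmonic, which excludes an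
   interior maximum without any connectedness argument. *)
Lemma maximum_modulus (g : C -> C) (r rho M : R) :
  (forall z, 0 < Cmod z < r -> exists l, cderiv g z l) ->
  (forall eps, 0 < eps -> exists d, 0 < d /\
     forall z, Cmod z < d -> Cmod (g z - g 0%C)%C <= eps) ->
  0 < rho < r ->
  (forall z, Cmod z = rho -> Cmod (g z) <= M) ->
  forall z, Cmod z <= rho -> Cmod (g z) <= M.
Proof.
intros Hg Hg0 Hrho HM. pose proof PI_RGT_0 as HPI.
assert (Hcont : forall z, Cmod z < r -> forall eps, 0 < eps -> exists d, 0 < d /\
  forall w, Cmod (w - z)%C < d -> Cmod (g w - g z)%C < eps).
{ intros z Hz eps He. destruct (Ceq_dec z 0%C) as [->|Hz0].
  - destruct (Hg0 (eps / 2)) as [d [Hd H]]; [lra|]. exists d. split; trivial.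
    intros w Hw. rewrite Cminus_0_r in Hw. specialize (H w Hw). lra.
  - apply Cmod_gt_0 in Hz0. destruct (Hg z (conj Hz0 Hz)) as [l Hl].
    now apply (cderiv_continuous g z l). }
assert (Hall : forall eps, 0 < eps -> forall z, Cmod z <= rho -> Cmod (g z) <= M + eps * rho ^ 2).
{ intros eps He.
  destruct (compact_min (fun z => Cmod z <= rho) rho (fun z => - (Cmod (g z) + eps * Cmod z ^ 2)))
    as [zs [Hzs Hmax]]; trivial.
  - apply closed_disc_complement.
  - intros z Hz e He'.
    destruct (Hcont z ltac:(lra) (e / 2)) as [d [Hd H]]; [lra|].
    assert (Hd' : 0 < e / (4 * eps * rho)).
    { apply Rdiv_lt_0_compat; trivial. apply Rmult_lt_0_compat; lra. }
    exists (Rmin d (e / (4 * eps * rho))). split; [now apply Rmin_pos|].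
    intros w Hw Hwz.
    assert (K1 : Cmod (w - z)%C < d) by (apply Rlt_le_trans with (1 := Hwz); apply Rmin_l).
    assert (K2 : Cmod (w - z)%C < e / (4 * eps * rho)) by (apply Rlt_le_trans with (1 := Hwz); apply Rmin_r).
    specialize (H w K1).
    pose proof (Cmod_Cmod_minus (g w) (g z)) as H1. pose proof (Cmod_Cmod_minus w z) as H2.
    pose proof (Cmod_ge_0 w). pose proof (Cmod_ge_0 z).
    apply Rmult_lt_compat_l with (r := 2 * eps * rho) in K2; [|apply Rmult_lt_0_compat; lra].
    replace (2 * eps * rho * (e / (4 * eps * rho))) with (e / 2) in K2 by (field; lra).
    replace (- (Cmod (g w) + eps * Cmod w ^ 2) - - (Cmod (g z) + eps * Cmod z ^ 2)) with
      (- (Cmod (g w) - Cmod (g z)) + - (eps * (Cmod w + Cmod z) * (Cmod w - Cmod z))) by ring.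
    eapply Rle_lt_trans; [apply Rabs_triang|]. rewrite !Rabs_Ropp.
    apply Rle_lt_trans with (Cmod (g w - g z)%C + 2 * eps * rho * Cmod (w - z)%C); [|lra].
    apply Rplus_le_compat; trivial. rewrite Rabs_mult, (Rabs_pos_eq (eps * (Cmod w + Cmod z))) by nra.
    apply Rmult_le_compat; trivial; try apply Rabs_pos; nra.
  - exists 0%C. rewrite Cmod_0. lra.
  - assert (Hb : Cmod zs = rho).
    { apply NNPP. intros Hne. assert (Hlt : Cmod zs < rho) by lra.
      (* The punctured disc of radius 2 s must avoid 0, where [g] is only continuous; for zs = 0 the
         puncture does this. *)
      assert (Hs : exists s, 0 < s /\ s < rho - Cmod zs /\ forall z, 0 < Cmod (z - zs)%C < 2 * s -> 0 < Cmod z < r).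
      { destruct (Ceq_dec zs 0%C) as [E|E].
        - exists (rho / 2). subst zs. rewrite Cmod_0 in *. split; [lra|]. split; [lra|].
          intros z Hz. rewrite Cminus_0_r in Hz. lra.
        - apply Cmod_gt_0 in E. exists (Rmin (Cmod zs) (rho - Cmod zs) / 2).
          assert (0 < Rmin (Cmod zs) (rho - Cmod zs)) by (apply Rmin_pos; lra).
          generalize (Rmin_l (Cmod zs) (rho - Cmod zs)) (Rmin_r (Cmod zs) (rho - Cmod zs)). intros.
          split; [lra|]. split; [lra|]. intros z Hz.
          pose proof (Cmod_Cmod_minus z zs) as Hz'. apply Rabs_le_between in Hz'. lra. }
      destruct Hs as (s & Hs1 & Hs2 & Hs3).
      destruct (exists_rotation (g zs)) as [u [Hu1 Hu2]].
      (* The linear term is the holomorphic part of eps |z|^2 around [zs]. Maximality at [zs] gives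
         Re G <= |g zs| - eps s^2 on the circle, whereas the average of Re G there is |g zs|. *)
      pose (G := fun z => (u * g z + (2 * eps)%R * Cconj zs * (z - zs))%C).
      assert (HG : forall z, 0 < Cmod (z - zs)%C < 2 * s -> exists l, cderiv G z l).
      { intros z Hz. destruct (Hg z (Hs3 z Hz)) as [l Hl]. eexists.
        apply cderiv_plus; [apply cderiv_scal, Hl|]. apply cderiv_scal.
        apply cderiv_minus; [apply cderiv_id|apply cderiv_const]. }
      assert (Hmv := circle_mean_value G zs (G zs) (2 * s) s HG).
      assert (EG : Re (G zs) = Cmod (g zs)).
      { unfold G. replace (u * g zs + (2 * eps)%R * Cconj zs * (zs - zs))%C with (u * g zs)%C by ring. exact Hu2. }
      rewrite EG in Hmv.
      assert (Hle : RInt (fun t => Re (G (circle_pt zs s t))) 0 (2 * PI) <= RInt (fun _ => Cmod (g zs) - eps * s ^ 2) 0 (2 * PI)).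
      { apply RInt_le; [lra| |apply ex_RInt_const|].
        { apply ex_RInt_circle; trivial. intros z Hz. apply HG. lra. }
        intros t _. set (z := circle_pt zs s t).
        assert (Ez : Cmod (z - zs)%C = s) by (apply Cmod_circle_pt; lra).
        assert (Hz : Cmod z <= rho).
        { pose proof (Cmod_Cmod_minus z zs) as Hz'. apply Rabs_le_between in Hz'. lra. }
        specialize (Hmax z Hz). rewrite (Cmod_sqr_shift z zs), Ez in Hmax.
        assert (Re (u * g z)%C <= Cmod (g z)).
        { apply Rle_trans with (1 := Re_le_Cmod _). rewrite Cmod_mult, Hu1. lra. }
        unfold G. rewrite re_plus, <- Cmult_assoc, re_scal_l. lra. }
      rewrite RInt_const in Hle. rewrite Hmv in Hle; clear Hmv.
      - change (2 * PI * Cmod (g zs) <= (2 * PI - 0) * (Cmod (g zs) - eps * s ^ 2)) in Hle.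
        assert (0 < eps * s ^ 2) by (apply Rmult_lt_0_compat; trivial; now apply pow_lt). nra.
      - intros e He'.
        assert (HGz : forall z, (G z - G zs)%C = (u * (g z - g zs) + (2 * eps)%R * Cconj zs * (z - zs))%C).
        { intros z. unfold G. ring. }
        assert (Hzs0 := Cmod_ge_0 zs).
        destruct (Hcont zs ltac:(lra) (e / 2)) as [d [Hd H]]; [lra|].
        assert (Hd' : 0 < e / (4 * eps * (Cmod zs + 1))).
        { apply Rdiv_lt_0_compat; trivial. apply Rmult_lt_0_compat; lra. }
        exists (Rmin d (e / (4 * eps * (Cmod zs + 1)))). split; [now apply Rmin_pos|].
        intros z [Hz1 Hz2]. rewrite HGz.
        assert (K1 : Cmod (z - zs)%C < d) by (apply Rlt_le_trans with (1 := Hz2); apply Rmin_l).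
        assert (K2 : Cmod (z - zs)%C < e / (4 * eps * (Cmod zs + 1))) by (apply Rlt_le_trans with (1 := Hz2); apply Rmin_r).
        specialize (H z K1).
        apply Rmult_lt_compat_l with (r := 2 * eps * (Cmod zs + 1)) in K2; [|apply Rmult_lt_0_compat; lra].
        replace (2 * eps * (Cmod zs + 1) * (e / (4 * eps * (Cmod zs + 1)))) with (e / 2) in K2 by (field; lra).
        eapply Rle_trans; [apply Cmod_triangle|].
        rewrite !Cmod_mult, Hu1, Cmod_conj, Cmod_R, Rabs_pos_eq by lra. nra.
      - lra. }
    intros z Hz. specialize (Hmax z Hz). specialize (HM zs Hb).
    rewrite Hb in Hmax. assert (0 <= eps * Cmod z ^ 2).
    { apply Rmult_le_pos; [lra|]. apply pow_le, Cmod_ge_0. }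
    lra. }
intros z Hz. apply Rnot_lt_le. intros Hlt.
assert (Hr2 : 0 < rho ^ 2) by (apply pow_lt; lra).
specialize (Hall ((Cmod (g z) - M) / (2 * rho ^ 2)) ltac:(apply Rdiv_lt_0_compat; lra) z Hz).
replace ((Cmod (g z) - M) / (2 * rho ^ 2) * rho ^ 2) with ((Cmod (g z) - M) / 2) in Hall by (field; lra).
lra.
Qed.

(** The maximum principle for w(z) / z on circles of radius rho < r, then rho tends to r. *)
Lemma schwarz (w : C -> C) r : 0 < r ->
  (forall z, Cmod z < r -> exists l, cderiv w z l) ->
  w 0%C = 0%C -> (forall z, Cmod z < r -> Cmod (w z) <= 1) ->
  forall z, Cmod z < r -> r * Cmod (w z) <= Cmod z.
Proof.
intros Hr Hw Hw0 Hw1 z Hz.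
destruct (Ceq_dec z 0%C) as [->|Hz0].
{ rewrite Hw0, Cmod_0. lra. }
apply Cmod_gt_0 in Hz0 as Hz1.
destruct (Hw 0%C) as [a Ha]; [rewrite Cmod_0; lra|].
assert (Hmain : forall rho, Cmod z < rho < r -> Cmod (w z) * rho <= Cmod z).
{ intros rho Hrho.
  assert (H : Cmod (quot w a z) <= / rho).
  { apply (maximum_modulus (quot w a) r rho); try lra.
    - intros y [Hy1 Hy2]. destruct (Hw y Hy2) as [l Hl]. eexists.
      apply cderiv_quot_neq_0; [now apply Cmod_gt_0|exact Hl].
    - rewrite quot_0. now apply quot_continuous_0.
    - intros y Hy. assert (Hy0 : y <> 0%C) by (apply Cmod_gt_0; lra).
      rewrite quot_neq_0, Cmod_div, Hy by trivial.
      rewrite <- (Rmult_1_l (/ rho)). apply Rmult_le_compat_r; [left; apply Rinv_0_lt_compat; lra|].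
      apply Hw1. lra. }
  rewrite quot_neq_0, Cmod_div in H by trivial.
  apply Rmult_le_compat_r with (r := Cmod z * rho) in H; [|apply Rmult_le_pos; lra].
  replace (Cmod (w z) / Cmod z * (Cmod z * rho)) with (Cmod (w z) * rho) in H by (field; lra).
  replace (/ rho * (Cmod z * rho)) with (Cmod z) in H by (field; lra).
  exact H. }
pose proof (Cmod_ge_0 (w z)) as Hwz.
apply Rnot_lt_le. intros Hlt.
assert (Hwz1 : Cmod (w z) <= 1) by now apply Hw1.
assert (Hp : 0 < Cmod (w z)) by nra.
(* If the claim failed, |z| / |w z| would be less than r, and the midpoint is an admissible [rho]
   violating [Hmain]. *)
specialize (Hmain ((Cmod z / Cmod (w z) + r) / 2)).
assert (Hq : Cmod z / Cmod (w z) < r).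
{ apply Rmult_lt_reg_r with (Cmod (w z)); trivial. unfold Rdiv. rewrite Rmult_assoc, Rinv_l; lra. }
assert (Hq2 : Cmod z <= Cmod z / Cmod (w z)).
{ apply Rmult_le_reg_r with (Cmod (w z)); trivial. unfold Rdiv. rewrite Rmult_assoc, Rinv_l; nra. }
specialize (Hmain ltac:(lra)).
replace (Cmod (w z) * ((Cmod z / Cmod (w z) + r) / 2)) with ((Cmod z + r * Cmod (w z)) / 2) in Hmain by (field; lra).
lra.
Qed.

(** * Positivity of the real part of f / (z f') *)

Lemma right_derivative_nonneg (phi : R -> R) l d : 0 < d -> phi 0 = 0 ->
  (forall t, 0 < t < d -> 0 <= phi t) -> derivable_pt_lim phi 0 l -> 0 <= l.
Proof.
intros Hd H0 Hphi Hl. apply Rnot_lt_le. intros Hneg.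
destruct (Hl (- l) ltac:(lra)) as [delta H]. pose proof (cond_pos delta) as Hdel.
set (t := Rmin d delta / 2).
assert (Hm : 0 < Rmin d delta) by (apply Rmin_pos; trivial).
generalize (Rmin_l d delta) (Rmin_r d delta). intros Hm1 Hm2.
assert (Ht : 0 < t) by (unfold t; lra).
specialize (H t ltac:(lra)). rewrite Rabs_pos_eq in H by lra.
specialize (H ltac:(unfold t; lra)). rewrite Rplus_0_l, H0, Rminus_0_r in H.
specialize (Hphi t ltac:(unfold t in *; lra)).
assert (0 <= phi t / t) by (apply Rmult_le_pos; [trivial|left; now apply Rinv_0_lt_compat]).
apply Rabs_lt_between in H. lra.
Qed.

Lemma Cmod2_1_plus (p : C) : Cmod (1 + p)%C ^ 2 = 1 + 2 * Re p + Cmod p ^ 2.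
Proof. rewrite !Cmod2_alt, re_plus, im_plus, re_RtoC, im_RtoC. ring. Qed.

Lemma Cmod2_1_minus (p : C) : Cmod (1 - p)%C ^ 2 = 1 - 2 * Re p + Cmod p ^ 2.
Proof. unfold Cminus. rewrite !Cmod2_alt, re_plus, im_plus, re_opp, im_opp, re_RtoC, im_RtoC. ring. Qed.

(* Schwarz's lemma for the Cayley transform [(1 - p) / (1 + p)]. *)
Lemma caratheodory_bound (p : C -> C) r : 0 < r ->
  (forall z, Cmod z < r -> exists l, cderiv p z l) ->
  p 0%C = 1%C -> (forall z, Cmod z < r -> 0 < Re (p z)) ->
  forall z, Cmod z < r ->
  0 <= (Cmod z ^ 2 - r ^ 2) * (1 + Cmod (p z) ^ 2) + 2 * (Cmod z ^ 2 + r ^ 2) * Re (p z).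
Proof.
intros Hr Hp Hp0 Hpos z Hz.
assert (Hne : forall z, Cmod z < r -> (1 + p z)%C <> 0%C).
{ intros y Hy E. apply (f_equal Re) in E. rewrite re_plus, !re_RtoC in E.
  specialize (Hpos y Hy). lra. }
assert (Hpos1 : forall z, Cmod z < r -> 0 < Cmod (1 + p z)%C) by (intros y Hy; now apply Cmod_gt_0, Hne).
assert (H : r * Cmod ((1 - p z) / (1 + p z))%C <= Cmod z).
{ apply (schwarz (fun z => (1 - p z) / (1 + p z))%C); trivial.
  - intros y Hy. destruct (Hp y Hy) as [l Hl]. eexists.
    apply (cderiv_div (fun z => 1 - p z)%C (fun z => 1 + p z)%C); [now apply Hne| |].
    + apply cderiv_minus; [apply cderiv_const|exact Hl].
    + apply cderiv_plus; [apply cderiv_const|exact Hl].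
  - rewrite Hp0. unfold Cdiv. replace (1 - 1)%C with (RtoC 0) by ring. apply Cmult_0_l.
  - intros y Hy. rewrite Cmod_div by now apply Hne. specialize (Hpos1 y Hy).
    apply Rmult_le_reg_r with (Cmod (1 + p y)%C); trivial.
    unfold Rdiv. rewrite Rmult_assoc, Rinv_l, Rmult_1_l, Rmult_1_r by lra.
    apply Rsqr_incr_0_var; [|lra].
    unfold Rsqr. pose proof (Cmod2_1_plus (p y)). pose proof (Cmod2_1_minus (p y)).
    specialize (Hpos y Hy). nra. }
rewrite Cmod_div in H by now apply Hne. specialize (Hpos1 z Hz).
apply Rmult_le_compat_r with (r := Cmod (1 + p z)%C) in H; [|lra].
replace (r * (Cmod (1 - p z)%C / Cmod (1 + p z)%C) * Cmod (1 + p z)%C) with (r * Cmod (1 - p z)%C) in H by (field; lra).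
assert (H2 : (r * Cmod (1 - p z)%C) ^ 2 <= (Cmod z * Cmod (1 + p z)%C) ^ 2).
{ apply pow_incr. split; trivial. apply Rmult_le_pos; [lra|apply Cmod_ge_0]. }
rewrite !Rpow_mult_distr, Cmod2_1_plus, Cmod2_1_minus in H2. lra.
Qed.

(** The expression in [caratheodory_bound] is nonnegative inside the disc and vanishes at [z0], so
    its derivative along each inward direction z0 (-1 + i mu) is nonnegative. Letting mu range over
    all reals forces Im (m z0) = 0, and mu = 0 gives the bound. *)
Lemma boundary_derivative (p : C -> C) (r b : R) (z0 m : C) : 0 < r ->
  (forall z, Cmod z < r -> exists l, cderiv p z l) ->
  p 0%C = 1%C -> (forall z, Cmod z < r -> 0 < Re (p z)) ->
  Cmod z0 = r -> p z0 = (0, b) -> cderiv p z0 m ->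
  Im (m * z0)%C = 0 /\ Re (m * z0)%C <= - (1 + b ^ 2) / 2.
Proof.
intros Hr Hp Hp0 Hpos Hz0 Hpz0 Hm.
assert (Hdir : forall mu, 0 <= - (1 + b ^ 2) + 2 * (- Re (m * z0)%C - Im (m * z0)%C * mu)).
{ intros mu. set (v := ((-1, mu) : C)).
  destruct (cderiv_line p z0 (z0 * v)%C 0 m) as [HX HY].
  { now replace (z0 + 0 * (z0 * v))%C with z0 by ring. }
  set (X := fun s : R => Re (p (z0 + s * (z0 * v))%C)) in *.
  set (Y := fun s : R => Im (p (z0 + s * (z0 * v))%C)) in *.
  assert (E0 : (z0 + 0 * (z0 * v))%C = z0) by ring.
  assert (X0 : X 0 = 0) by (unfold X; rewrite E0, Hpz0; reflexivity).
  assert (Y0 : Y 0 = b) by (unfold Y; rewrite E0, Hpz0; reflexivity).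
  (* [q t] is |z|^2 / r^2 at z = z0 (1 + t v). It is below 1 for 0 < t < 1 / (1 + mu^2), and [phi]
     below is the nonnegative expression divided by r^2. *)
  pose (q := fun t => 1 - 2 * t + t ^ 2 * (1 + mu ^ 2)).
  assert (Hq : forall t : R, Cmod (z0 + t * (z0 * v))%C ^ 2 = r ^ 2 * q t).
  { intros t. replace (z0 + t * (z0 * v))%C with (z0 * (1 + t * v))%C by ring.
    rewrite Cmod_mult, Rpow_mult_distr, Hz0, (Cmod2_alt (1 + t * v)%C).
    unfold v, q. rewrite re_plus, im_plus, re_scal_l, im_scal_l, re_RtoC, im_RtoC. unfold Re, Im; simpl. ring. }
  pose (phi := fun t => (q t - 1) * (1 + (X t ^ 2 + Y t ^ 2)) + 2 * (q t + 1) * X t).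
  assert (Hphi : 0 <= - 2 * (1 + b ^ 2) + 4 * Re (m * (z0 * v))%C).
  { apply (right_derivative_nonneg phi _ (/ (1 + mu ^ 2))).
    - apply Rinv_0_lt_compat. nra.
    - unfold phi, q. rewrite X0, Y0. ring.
    - intros t [Ht1 Ht2].
      assert (Ht3 : t * (1 + mu ^ 2) < 1).
      { apply Rmult_lt_compat_r with (r := 1 + mu ^ 2) in Ht2; [|nra].
        rewrite Rinv_l in Ht2; [trivial|]. apply Rgt_not_eq. nra. }
      assert (Hlt : Cmod (z0 + t * (z0 * v))%C < r).
      { apply Rsqr_incrst_0; [|apply Cmod_ge_0|lra]. rewrite !Rsqr_pow2, Hq.
        rewrite <- (Rmult_1_r (r ^ 2)) at 2. apply Rmult_lt_compat_l; [now apply pow_lt|].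
        unfold q. replace (t ^ 2 * (1 + mu ^ 2)) with (t * (t * (1 + mu ^ 2))) by ring. nra. }
      pose proof (caratheodory_bound p r Hr Hp Hp0 Hpos _ Hlt) as H.
      rewrite Hq, (Cmod2_alt (p _)) in H. fold (X t) (Y t) in H.
      apply Rmult_le_reg_l with (r ^ 2); [now apply pow_lt|].
      unfold phi. lra.
    - apply is_derive_Reals in HX. apply is_derive_Reals in HY. apply is_derive_Reals.
      unfold phi, q. auto_derive.
      + repeat split; trivial; eexists; eassumption.
      + change (fun s : R => X s) with X. change (fun s : R => Y s) with Y.
        rewrite (is_derive_unique _ _ _ HX), (is_derive_unique _ _ _ HY), X0, Y0. ring. }
  replace (Re (m * (z0 * v))%C) with (- Re (m * z0)%C - Im (m * z0)%C * mu) in Hphi.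
  - lra.
  - rewrite Cmult_assoc, (re_mult (m * z0)%C). unfold v, Re, Im; simpl. ring. }
set (A := Re (m * z0)%C) in *. set (B := Im (m * z0)%C) in *.
assert (HB : B = 0).
(* This [mu] makes the right-hand side of [Hdir] equal to -1. *)
{ apply NNPP. intros HB. specialize (Hdir ((1 - (1 + b ^ 2) - 2 * A) / (2 * B))).
  replace (B * ((1 - (1 + b ^ 2) - 2 * A) / (2 * B))) with ((1 - (1 + b ^ 2) - 2 * A) / 2) in Hdir by (field; trivial).
  lra. }
split; trivial. specialize (Hdir 0). lra.
Qed.

Lemma exists_first_boundary_point (p : C -> C) (z1 : C) :
  (forall z, Cmod z < 1 -> exists l, cderiv p z l) ->
  0 < Re (p 0%C) -> Cmod z1 < 1 -> Re (p z1) <= 0 ->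
  exists z0, 0 < Cmod z0 < 1 /\ Re (p z0) = 0 /\ forall z, Cmod z < Cmod z0 -> 0 < Re (p z).
Proof.
intros Hp Hp0 Hz1 Hneg.
assert (Hcont : forall z, Cmod z < 1 -> forall eps, 0 < eps -> exists d, 0 < d /\
   forall w, Cmod (w - z)%C < d -> Rabs (Re (p w) - Re (p z)) < eps).
{ intros z Hz eps He. destruct (Hp z Hz) as [l Hl].
  destruct (cderiv_continuous p z l Hl eps He) as [d [Hd H]]. exists d. split; trivial.
  intros w Hw. apply Rle_lt_trans with (2 := H w Hw).
  eapply Rle_trans; [|apply re_le_Cmod]. right. f_equal. }
destruct (compact_min (fun z => Cmod z <= Cmod z1 /\ Re (p z) <= 0) (Cmod z1) Cmod) as [z0 [[H1 H2] H3]].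
- now intros z [H _].
- intros z Hz. destruct (Rle_dec (Cmod z) (Cmod z1)) as [Hle|Hle].
  + assert (Hpz : 0 < Re (p z)) by (apply Rnot_le_lt; tauto).
    destruct (Hcont z ltac:(lra) (Re (p z)) Hpz) as [d [Hd H]]. exists d. split; trivial.
    intros w Hw [_ Hw2]. specialize (H w Hw). apply Rabs_lt_between in H. lra.
  + destruct (closed_disc_complement (Cmod z1) z Hle) as [d [Hd H]]. exists d. split; trivial.
    intros w Hw [Hw1 _]. now apply (H w Hw).
- intros z _ eps He. exists eps. split; trivial. intros w _ Hw.
  apply Rle_lt_trans with (2 := Hw). apply Cmod_Cmod_minus.
- exists z1. split; lra.
- assert (Hz0 : 0 < Cmod z0).
  { apply Cmod_gt_0. intros ->. lra. }
  assert (Hbelow : forall z, Cmod z < Cmod z0 -> 0 < Re (p z)).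
  { intros z Hz. apply Rnot_le_lt. intros Hn. specialize (H3 z ltac:(split; lra)). lra. }
  exists z0. split; [lra|]. split; trivial.
  apply Rle_antisym; trivial. apply Rnot_lt_le. intros Hlt.
  destruct (Hcont z0 ltac:(lra) (- Re (p z0)) ltac:(lra)) as [d [Hd H]].
  (* The point (1 - t) z0 has smaller modulus, hence positive real part of p; continuity then
     excludes a negative value at [z0]. *)
  set (t := Rmin 1 (d / 2)).
  assert (Ht : 0 < t) by (apply Rmin_pos; lra).
  assert (Ht1 : t <= 1) by apply Rmin_l. assert (Ht2 : t <= d / 2) by apply Rmin_r.
  specialize (H ((1 - t)%R * z0)%C). specialize (Hbelow ((1 - t)%R * z0)%C).
  rewrite Cmod_mult, Cmod_R, Rabs_pos_eq in Hbelow by lra. specialize (Hbelow ltac:(nra)).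
  replace ((1 - t)%R * z0 - z0)%C with ((- t)%R * z0)%C in H by (rewrite RtoC_minus, RtoC_opp; ring).
  rewrite Cmod_mult, Cmod_R, Rabs_Ropp, Rabs_pos_eq in H by lra. specialize (H ltac:(nra)).
  apply Rabs_lt_between in H. lra.
Qed.

Lemma class_A1_cderiv (f : C -> C) (hf : class_A1 f) :
  (forall z, Cmod z < 1 -> cderiv f z (C_derive f z)) /\ f 0%C = 0%C /\ C_derive f 0%C = 1%C.
Proof.
destruct hf as (H1 & H2 & H3). split; [|split]; trivial.
- intros z Hz. apply cderiv_C_derive. destruct (H1 z Hz) as [l Hl]. exists l. now apply cderiv_is_derive.
- now apply Ceq_minus.
Qed.

Lemma disc_ball (u z : C) : Cmod (z - u)%C < 1 - Cmod u -> Cmod z < 1.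
Proof.
intros H. pose proof (Cmod_Cmod_minus z u) as H'. apply Rabs_le_between in H'. lra.
Qed.

Lemma class_A1_cderiv2 (f : C -> C) (hf : class_A1 f) (z : C) : Cmod z < 1 ->
  cderiv (C_derive f) z (C_derive (C_derive f) z).
Proof.
intros Hz. apply cderiv_C_derive. apply (C_derive_differentiable f z (1 - Cmod z)); [lra|].
intros w Hw. exists (C_derive f w). apply (proj1 (class_A1_cderiv f hf)). now apply disc_ball with z.
Qed.

Lemma Re_quot_pos (f : C -> C) (hf : class_A1 f)
  (hf' : forall z : C, unit_disc z -> C_derive f z <> 0%C)
  (hIm : forall z : C, unit_disc z ->
     Rabs (Im (z * C_derive (C_derive f) z / C_derive f z)%C) < sqrt 3) :
  forall z, Cmod z < 1 -> 0 < Re (quot f 1 z / C_derive f z)%C.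
Proof.
destruct (class_A1_cderiv f hf) as (Hf & Hf0 & Hf1).
pose proof (class_A1_cderiv2 f hf) as Hf2.
pose (p := fun z => (quot f 1 z / C_derive f z)%C).
assert (Hp : forall z, Cmod z < 1 -> exists l, cderiv p z l).
{ intros z Hz. destruct (Ceq_dec z 0%C) as [->|Hz0].
  - eexists. apply cderiv_div; [now apply hf'| |now apply Hf2].
    rewrite <- Hf1. eapply (cderiv_quot_0 f _ 1); trivial; [lra| |now apply Hf2].
    intros w Hw. eexists; now apply Hf.
  - eexists. apply cderiv_div; [now apply hf'| |now apply Hf2].
    apply cderiv_quot_neq_0; [trivial|now apply Hf]. }
assert (Hp0 : p 0%C = 1%C) by (unfold p; rewrite quot_0, Hf1; field).
intros z1 Hz1. apply Rnot_le_lt. intros Hneg.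
destruct (exists_first_boundary_point p z1) as (z0 & Hz0 & Hre & Hpos); trivial.
{ rewrite Hp0, re_RtoC. lra. }
set (b := Im (p z0)).
assert (Hpz0 : p z0 = (0, b)) by (rewrite <- Hre; unfold b; now destruct (p z0)).
assert (Hz0' : z0 <> 0%C) by (apply Cmod_gt_0; lra).
set (P := (z0 * C_derive (C_derive f) z0 / C_derive f z0)%C).
assert (HY : Rabs (Im P) < sqrt 3) by (apply hIm; unfold unit_disc; lra).
assert (Hd : C_derive f z0 <> 0%C) by (apply hf'; unfold unit_disc; lra).
assert (Hm := cderiv_div (quot f 1) (C_derive f) z0 _ _ Hd
  (cderiv_quot_neq_0 f 1 z0 _ Hz0' (Hf z0 ltac:(lra))) (Hf2 z0 ltac:(lra))).
change (cderiv p z0 ((((C_derive f z0 * z0 - f z0) / (z0 * z0)) * C_derive f z0 -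
  quot f 1 z0 * C_derive (C_derive f) z0) / (C_derive f z0 * C_derive f z0))%C) in Hm.
match type of Hm with cderiv _ _ ?m => set (m0 := m) in * end.
assert (Ez : (m0 * z0)%C = (1 - (1 + P) * p z0)%C).
{ unfold m0, P, p. rewrite !quot_neq_0 by trivial. field. now split. }
destruct (boundary_derivative p (Cmod z0) b z0 m0) as [_ HA]; trivial; try lra.
{ intros z Hz. apply Hp. lra. }
assert (HRe : Re (m0 * z0)%C = 1 + Im P * b).
{ rewrite Ez. unfold Cminus. rewrite re_plus, re_opp, re_mult, im_plus, Hpz0, im_RtoC, re_RtoC.
  unfold Re at 1, Im at 2; simpl. fold (Im P). unfold Im; simpl. ring. }
rewrite HRe in HA.
assert (Hs : sqrt 3 * sqrt 3 = 3) by (apply sqrt_sqrt; lra).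
apply Rabs_lt_between in HY.
assert (0 < sqrt 3) by (apply sqrt_lt_R0; lra).
pose proof (pow2_ge_0 (b + sqrt 3)) as Hsq1. pose proof (pow2_ge_0 (b - sqrt 3)) as Hsq2.
(* For b <> 0 the strict bound on Im P turns [HA] into (|b| - sqrt 3)^2 < 0; for b = 0 it reads 1 <=
   -1/2. *)
destruct (Rtotal_order b 0) as [Hb|[Hb|Hb]].
- assert (sqrt 3 * b < Im P * b) by (nra). nra.
- rewrite Hb in HA. lra.
- assert (- sqrt 3 * b < Im P * b) by (apply Rmult_lt_compat_r; lra). nra.
Qed.

(** * Starlikeness and injectivity *)

(** A damped Newton step h = - t (f z - w) / l multiplies f - w by 1 - t to first order; the
    remainder costs at most half of the gain. *)
Lemma no_nonzero_local_min (f : C -> C) (z l w : C) d : 0 < d ->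
  cderiv f z l -> l <> 0%C -> f z <> w ->
  exists h, Cmod h < d /\ Cmod (f (z + h) - w)%C < Cmod (f z - w)%C.
Proof.
intros Hd Hf Hl Hw. apply Cmod_gt_0 in Hl as Hl'.
set (e := (f z - w)%C). assert (He : e <> 0%C) by now apply Cminus_eq_contra.
apply Cmod_gt_0 in He as He'.
destruct (Hf (Cmod l / 2)) as [d1 [Hd1 H]]; [lra|].
assert (Hq : 0 < Cmod (e / l)%C) by (rewrite Cmod_div by trivial; now apply Rdiv_lt_0_compat).
set (t := Rmin 1 (Rmin d d1 / (2 * Cmod (e / l)%C))).
assert (Hm : 0 < Rmin d d1) by now apply Rmin_pos.
assert (Ht : 0 < t) by (apply Rmin_pos; [lra|apply Rdiv_lt_0_compat; lra]).
assert (Ht1 : t <= 1) by apply Rmin_l.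
assert (Ht2 : t * Cmod (e / l)%C < Rmin d d1).
{ apply Rle_lt_trans with (Rmin d d1 / (2 * Cmod (e / l)%C) * Cmod (e / l)%C).
  - apply Rmult_le_compat_r; [lra|apply Rmin_r].
  - replace (Rmin d d1 / (2 * Cmod (e / l)%C) * Cmod (e / l)%C) with (Rmin d d1 / 2) by (field; lra). lra. }
generalize (Rmin_l d d1) (Rmin_r d d1). intros Hm1 Hm2.
assert (Eh : Cmod (- (t * (e / l)))%C = t * Cmod (e / l)%C).
{ rewrite Cmod_opp, Cmod_mult, Cmod_R, Rabs_pos_eq by lra. trivial. }
exists (- (t * (e / l)))%C. rewrite Eh. split; [lra|].
specialize (H (- (t * (e / l)))%C). rewrite Eh in H. specialize (H ltac:(lra)).
set (z' := (z + - (t * (e / l)))%C) in *.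
replace (f z' - w)%C with ((f z' - f z - l * - (t * (e / l))) + (1 - t)%R * e)%C.
2:{ unfold e. rewrite RtoC_minus. field. trivial. }
eapply Rle_lt_trans; [apply Cmod_triangle|].
rewrite (Cmod_mult (1 - t)%R), Cmod_R, Rabs_pos_eq by lra.
rewrite Cmod_div in H by trivial.
replace (Cmod l / 2 * (t * (Cmod e / Cmod l))) with (t * Cmod e / 2) in H by (field; lra).
assert (0 < t * Cmod e) by now apply Rmult_lt_0_compat. lra.
Qed.

(** A minimiser of |f - w| over a small closed disc is interior, since [f] moves away from f(z0) at
    rate |l| / 2, and an interior minimum must be zero. The same rate yields the linear bound on z -
    z0. *)
Lemma quantitative_open_mapping (f : C -> C) (z0 : C) d : 0 < d ->
  (forall z, Cmod (z - z0)%C < d -> exists l, cderiv f z l /\ l <> 0%C) ->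
  exists k eta, 0 < k /\ 0 < eta /\ forall w, Cmod (w - f z0)%C < eta ->
    exists z, Cmod (z - z0)%C < d /\ f z = w /\ Cmod (z - z0)%C <= k * Cmod (w - f z0)%C.
Proof.
intros Hd Hf.
assert (E0 : Cmod (z0 - z0)%C = 0) by (replace (z0 - z0)%C with (RtoC 0) by ring; apply Cmod_0).
destruct (Hf z0 ltac:(lra)) as [l [Hl Hl0]]. apply Cmod_gt_0 in Hl0.
set (a := Cmod l / 2). assert (Ha : 0 < a) by (unfold a; lra).
destruct (Hl a Ha) as [d1 [Hd1 H1]].
set (rho := Rmin d d1 / 2).
assert (Hrho : 0 < rho) by (assert (0 < Rmin d d1) by (now apply Rmin_pos); unfold rho; lra).
assert (Hrd : rho < d) by (generalize (Rmin_l d d1); unfold rho in *; lra).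
assert (Hrd1 : rho < d1) by (generalize (Rmin_r d d1); unfold rho in *; lra).
clearbody rho.
assert (Hlow : forall z, Cmod (z - z0)%C <= rho -> a * Cmod (z - z0)%C <= Cmod (f z - f z0)%C).
{ intros z Hz. specialize (H1 (z - z0)%C ltac:(lra)).
  replace (z0 + (z - z0))%C with z in H1 by ring.
  assert (H2 : Cmod (l * (z - z0))%C <= Cmod (f z - f z0)%C + Cmod (f z - f z0 - l * (z - z0))%C).
  { replace (l * (z - z0))%C with ((f z - f z0) + - (f z - f z0 - l * (z - z0)))%C at 1 by ring.
    rewrite <- (Cmod_opp (f z - f z0 - l * (z - z0))%C). apply Cmod_triangle. }
  rewrite Cmod_mult in H2. unfold a in *. lra. }
(* For such [w] the distance |f - w| is below a rho / 2 at the centre and above a rho / 2 on the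
   circle of radius [rho]. *)
exists (/ a), (a * rho / 2).
assert (Har : 0 < a * rho) by now apply Rmult_lt_0_compat.
split; [now apply Rinv_0_lt_compat|]. split; [lra|].
intros w Hw.
destruct (compact_min (fun z => Cmod (z - z0)%C <= rho) (Cmod z0 + rho) (fun z => Cmod (f z - w)%C))
  as [zs [Hzs Hmin]].
- intros z Hz. replace z with (z0 + (z - z0))%C by ring. eapply Rle_trans; [apply Cmod_triangle|]. lra.
- intros z Hz. destruct (closed_disc_complement rho (z - z0)%C Hz) as [e [He H]].
  exists e. split; trivial. intros y Hy. apply H. now replace (y - z0 - (z - z0))%C with (y - z)%C by ring.
- intros z Hz eps He. destruct (Hf z ltac:(lra)) as [m [Hm _]].
  destruct (cderiv_continuous f z m Hm eps He) as [e [He' H]]. exists e. split; trivial.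
  intros y _ Hy. apply Rle_lt_trans with (2 := H y Hy).
  apply Rle_trans with (1 := Cmod_Cmod_minus _ _). right. f_equal. ring.
- exists z0. lra.
- assert (Hat0 : Cmod (f zs - w)%C < a * rho / 2).
  { apply Rle_lt_trans with (2 := Hw). apply Rle_trans with (1 := Hmin z0 ltac:(lra)).
    rewrite <- Cmod_opp. right. f_equal. ring. }
  assert (Hint : Cmod (zs - z0)%C < rho).
  { apply Rnot_le_lt. intros Hge. specialize (Hlow zs Hzs).
    assert (Hle : Cmod (f zs - f z0)%C <= Cmod (f zs - w)%C + Cmod (w - f z0)%C).
    { replace (f zs - f z0)%C with ((f zs - w) + (w - f z0))%C by ring. apply Cmod_triangle. }
    nra. }
  exists zs. split; [lra|].
  assert (E : f zs = w).
  { apply NNPP. intros Hne. destruct (Hf zs ltac:(lra)) as [m [Hm Hm0]].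
    destruct (no_nonzero_local_min f zs m w (rho - Cmod (zs - z0)%C) ltac:(lra) Hm Hm0 Hne) as [h [Hh1 Hh2]].
    specialize (Hmin (zs + h)%C). replace (zs + h - z0)%C with ((zs - z0) + h)%C in Hmin by ring.
    pose proof (Cmod_triangle (zs - z0)%C h). specialize (Hmin ltac:(lra)). lra. }
  split; trivial. specialize (Hlow zs Hzs). rewrite E in Hlow.
  apply Rmult_le_reg_l with a; trivial. rewrite <- Rmult_assoc, Rinv_r by lra. lra.
Qed.

(** By continuity of f' at [u], the map f(y) - a y is Lipschitz with constant |a| / 2 near [u], too
    small to compensate a (z - w). *)
Lemma locally_injective (f : C -> C) (u : C) d :  0 < d ->
  (forall z, Cmod (z - u)%C < d -> cderiv f z (C_derive f z)) ->
  C_derive f u <> 0%C -> (exists m, cderiv (C_derive f) u m) ->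
  exists e, 0 < e /\ forall z w, Cmod (z - u)%C < e -> Cmod (w - u)%C < e -> f z = f w -> z = w.
Proof.
intros Hd Hf Hne [m Hm]. apply Cmod_gt_0 in Hne. set (a := C_derive f u) in *.
destruct (cderiv_continuous _ _ _ Hm (Cmod a / 2)) as [d1 [Hd1 H1]]; [lra|].
exists (Rmin d d1). split; [now apply Rmin_pos|].
generalize (Rmin_l d d1) (Rmin_r d d1). intros Hm1 Hm2 z w Hz Hw E.
assert (H : Cmod ((f z - a * z) - (f w - a * w))%C <= Cmod a / 2 * Cmod (z - w)%C).
{ apply (ball_mean_value_inequality (fun y => f y - a * y)%C u w z (Rmin d d1)); trivial.
  intros y Hy. exists (C_derive f y - a * 1)%C. split.
  - apply cderiv_minus; [apply Hf; lra|apply cderiv_scal, cderiv_id].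
  - rewrite Cmult_1_r. left. apply H1. lra. }
rewrite E in H. replace (f w - a * z - (f w - a * w))%C with (- (a * (z - w)))%C in H by ring.
rewrite Cmod_opp, Cmod_mult in H.
apply NNPP. intros Hzw. apply Cminus_eq_contra in Hzw. apply Cmod_gt_0 in Hzw. nra.
Qed.

(** Eventually as t tends to 0 from the right; finitely many smallness conditions can be
    intersected. *)
Definition small_pos (P : R -> Prop) := exists d, 0 < d /\ forall t, 0 < t < d -> P t.

Lemma small_pos_and P Q : small_pos P -> small_pos Q -> small_pos (fun t => P t /\ Q t).
Proof.
intros [d [Hd H]] [e [He H']]. exists (Rmin d e). split; [now apply Rmin_pos|].
generalize (Rmin_l d e) (Rmin_r d e). intros. split; [apply H|apply H']; lra.
Qed.

Lemma small_pos_mult_lt a b : 0 <= a -> 0 < b -> small_pos (fun t => t * a < b).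
Proof.
intros Ha Hb. exists (b / (a + 1)). split; [apply Rdiv_lt_0_compat; lra|].
intros t [Ht1 Ht2]. apply Rmult_lt_compat_r with (r := a + 1) in Ht2; [|lra].
replace (b / (a + 1) * (a + 1)) with b in Ht2 by (field; lra). nra.
Qed.

Lemma small_pos_mono (P Q : R -> Prop) : (forall t, 0 < t -> P t -> Q t) -> small_pos P -> small_pos Q.
Proof. intros H [d [Hd HP]]. exists d. split; trivial. intros t Ht. apply H; [lra|now apply HP]. Qed.

(** |1 - t p|^2 = 1 - 2 t Re p + t^2 |p|^2 <= 1 - t Re p <= (1 - t Re p / 2)^2. *)
Lemma Cmod_1_minus_scaled (p : C) t : 0 < t -> t * Re p < 1 -> t * Cmod p ^ 2 < Re p ->
  Cmod (1 - t * p)%C <= 1 - t * Re p / 2.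
Proof.
intros Ht H1 H2. apply Rsqr_incr_0_var; [|lra].
rewrite !Rsqr_pow2, Cmod2_1_minus, re_scal_l, Cmod_mult, Cmod_R, Rabs_pos_eq by lra.
assert (t * (t * Cmod p ^ 2) <= t * Re p) by (apply Rmult_le_compat_l; lra). nra.
Qed.

(* To first order [f u' = (1 - t) f u] forces [u' = u (1 - t p)], which is
   closer to the origin than [u] because [Re p > 0]. *)
Lemma move_inward (f : C -> C) (u : C) d e : 0 < d -> 0 < e ->
  (forall z, Cmod (z - u)%C < d -> exists l, cderiv f z l /\ l <> 0%C) ->
  u <> 0%C -> 0 < Re (f u / u / C_derive f u)%C ->
  small_pos (fun t => exists u', f u' = ((1 - t)%R * f u)%C /\ Cmod u' < Cmod u /\ Cmod (u' - u)%C < e).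
Proof.
intros Hd He Hf Hu Hp. set (p := (f u / u / C_derive f u)%C) in *.
assert (E0 : Cmod (u - u)%C = 0) by (replace (u - u)%C with (RtoC 0) by ring; apply Cmod_0).
destruct (Hf u ltac:(lra)) as [l [Hl Hl0]].
assert (El : C_derive f u = l) by now apply C_derive_cderiv.
assert (Efu : f u = (p * u * l)%C) by (unfold p; rewrite El; field; now split).
apply Cmod_gt_0 in Hl0 as Hl1. apply Cmod_gt_0 in Hu as Hu1.
destruct (quantitative_open_mapping f u d Hd Hf) as (k & eta & Hk & Heta & Hop).
set (N := Cmod (f u)). assert (HN : 0 <= N) by apply Cmod_ge_0.
assert (HkN : 0 <= k * N) by (apply Rmult_le_pos; lra).
(* t X is the decrease of modulus guaranteed by u (1 - t p). Since |u' - u| <= k t N, the choice of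
   [eps] keeps the remainder divided by [l] below it. *)
set (X := Cmod u * Re p / 2). assert (HX : 0 < X) by (assert (0 < Cmod u * Re p) by (now apply Rmult_lt_0_compat); unfold X; lra).
set (eps := X * Cmod l / (2 * (k * N + 1))).
assert (Heps : 0 < eps) by (apply Rdiv_lt_0_compat; [now apply Rmult_lt_0_compat|lra]).
destruct (Hl eps Heps) as [d1 [Hd1 H1]].
pose proof (small_pos_and _ _ (small_pos_mult_lt N eta HN Heta)
  (small_pos_and _ _ (small_pos_mult_lt (k * N) (Rmin e d1) HkN (Rmin_pos _ _ He Hd1))
  (small_pos_and _ _ (small_pos_mult_lt (Re p) 1 (Rlt_le _ _ Hp) Rlt_0_1)
   (small_pos_mult_lt (Cmod p ^ 2) (Re p) (pow_le _ 2 (Cmod_ge_0 p)) Hp)))) as Hsmall.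
revert Hsmall. apply small_pos_mono. intros t Ht (K1 & K2 & K3 & K4).
assert (Ew : Cmod ((1 - t)%R * f u - f u)%C = t * N).
{ replace ((1 - t)%R * f u - f u)%C with ((- t)%R * f u)%C by (rewrite RtoC_minus, RtoC_opp; ring).
  rewrite Cmod_mult, Cmod_R, Rabs_Ropp, Rabs_pos_eq by lra. reflexivity. }
destruct (Hop ((1 - t)%R * f u)%C) as (u' & Hu'1 & Hu'2 & Hu'3); [lra|].
rewrite Ew in Hu'3.
generalize (Rmin_l e d1) (Rmin_r e d1). intros Hm1 Hm2.
assert (Hclose : Cmod (u' - u)%C < Rmin e d1) by lra.
exists u'. split; [trivial|]. split; [|lra].
specialize (H1 (u' - u)%C ltac:(lra)).
replace (u + (u' - u))%C with u' in H1 by ring.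
set (r := (f u' - f u - l * (u' - u))%C) in *.
assert (Eu' : u' = (u * (1 - t * p) - r / l)%C).
{ unfold r. rewrite Hu'2, Efu, RtoC_minus. field. trivial. }
assert (Hr : Cmod (r / l)%C < t * X).
{ rewrite Cmod_div by trivial.
  apply Rmult_lt_reg_r with (Cmod l); trivial. unfold Rdiv. rewrite Rmult_assoc, Rinv_l, Rmult_1_r by lra.
  apply Rle_lt_trans with (1 := H1).
  apply Rle_lt_trans with (eps * (k * (t * N))); [apply Rmult_le_compat_l; lra|].
  replace (t * X * Cmod l) with (t * (eps * (2 * (k * N + 1)))) by (unfold eps; field; lra).
  replace (eps * (k * (t * N))) with (t * (eps * (k * N))) by ring.
  apply Rmult_lt_compat_l; trivial. apply Rmult_lt_compat_l; lra. }
pose proof (Cmod_1_minus_scaled p t Ht K3 K4) as H2.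
rewrite Eu'. unfold Cminus at 1. eapply Rle_lt_trans; [apply Cmod_triangle|].
rewrite Cmod_opp, Cmod_mult. unfold X in Hr. nra.
Qed.

(** The least s in [t, 1] for which s w is attained on |u| <= |z0| must be t: otherwise
    [move_inward] attains a slightly smaller multiple at a point of smaller modulus. *)
Lemma starlike_of_Re_pos (f : C -> C) :
  (forall z, Cmod z < 1 -> exists l, cderiv f z l /\ l <> 0%C) ->
  (forall z, Cmod z < 1 -> z <> 0%C -> 0 < Re (f z / z / C_derive f z)%C) ->
  f 0%C = 0%C -> starlike_wrt_origin (image unit_disc f).
Proof.
intros Hf Hp Hf0.
assert (H0 : image unit_disc f 0%C).
{ exists 0%C. split; trivial. unfold unit_disc. rewrite Cmod_0. lra. }
split; trivial. intros w t [z0 [Hz0 Hw]] Ht. unfold unit_disc in Hz0.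
destruct (Req_dec t 0) as [->|Ht0]; [now rewrite Cmult_0_l|].
destruct (Ceq_dec w 0%C) as [->|Hw0]; [now rewrite Cmult_0_r|].
(* Dividing by [w] makes the constraint f(u) = s w, s in [t, 1], a closed condition on Re F and Im
   F, with s = Re F. *)
pose (F := fun u => (f u / w)%C).
assert (HF : forall u, Cmod u < 1 -> forall eps, 0 < eps -> exists d, 0 < d /\
   forall v, Cmod (v - u)%C < d -> Cmod (F v - F u)%C < eps).
{ intros u Hu. destruct (Hf u Hu) as [l [Hl _]]. apply (cderiv_continuous F u (/ w * l)%C).
  apply cderiv_ext with (fun u => / w * f u)%C; [intros; unfold F; field; trivial|now apply cderiv_scal]. }
assert (HRI : forall a b : C, Rabs (Re a - Re b) <= Cmod (a - b)%C /\ Rabs (Im a - Im b) <= Cmod (a - b)%C).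
{ intros a b. split.
  - eapply Rle_trans; [|apply re_le_Cmod]. right. f_equal.
  - eapply Rle_trans; [|apply im_le_Cmod]. right. f_equal. }
destruct (compact_min (fun u => Cmod u <= Cmod z0 /\ Im (F u) = 0 /\ t <= Re (F u) <= 1) (Cmod z0)
   (fun u => Re (F u))) as (u & (Hu & Him & Hre) & Hmin).
- tauto.
- intros u Hu. destruct (Rle_dec (Cmod u) (Cmod z0)) as [Hle|Hle].
  + assert (Heps : exists eps, 0 < eps /\ forall v, Cmod (F v - F u)%C < eps -> ~ (Im (F v) = 0 /\ t <= Re (F v) <= 1)).
    { destruct (Req_dec (Im (F u)) 0) as [Hi|Hi].
      - destruct (Rlt_dec (Re (F u)) t) as [Hlt|Hlt].
        + exists (t - Re (F u)). split; [lra|]. intros v Hv (_ & Hv2).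
          destruct (HRI (F v) (F u)) as [HR _]. apply Rabs_le_between in HR. lra.
        + exists (Re (F u) - 1). split; [apply Rnot_le_lt; intros ?; apply Hu; repeat split; lra|].
          intros v Hv (_ & Hv2).
          destruct (HRI (F v) (F u)) as [HR _]. apply Rabs_le_between in HR. lra.
      - exists (Rabs (Im (F u))). split; [now apply Rabs_pos_lt|]. intros v Hv (Hv1 & _).
        destruct (HRI (F v) (F u)) as [_ HI]. rewrite Hv1, Rminus_0_l, Rabs_Ropp in HI. lra. }
    destruct Heps as [eps [He H]]. destruct (HF u ltac:(lra) eps He) as [d [Hd Hd2]].
    exists d. split; trivial. intros v Hv (_ & Hv2). now apply (H v (Hd2 v Hv)).
  + destruct (closed_disc_complement _ _ Hle) as [d [Hd H]]. exists d. split; trivial.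
    intros v Hv [Hv1 _]. now apply (H v Hv).
- intros u [Hu _] eps He. destruct (HF u ltac:(lra) eps He) as [d [Hd H]]. exists d. split; trivial.
  intros v _ Hv. apply Rle_lt_trans with (2 := H v Hv). apply HRI.
- exists z0. assert (E : F z0 = 1%C) by (unfold F; rewrite Hw; field; trivial).
  rewrite E, re_RtoC, im_RtoC. repeat split; lra.
- set (s := Re (F u)) in *.
  assert (Hfu : f u = (s * w)%C).
  { assert (EF : F u = s) by (unfold s; rewrite <- (im_RtoC s) in Him; destruct (F u); unfold Re, Im, RtoC in *; simpl in *; now rewrite Him).
    rewrite <- EF. unfold F. field. trivial. }
  destruct (Rle_lt_or_eq_dec t s (proj1 Hre)) as [Hlt|Heq].
  2:{ exists u. split; [unfold unit_disc; lra|]. now rewrite Hfu, Heq. }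
  exfalso.
  assert (Hu0 : u <> 0%C).
  { intros ->. rewrite Hf0 in Hfu. symmetry in Hfu. revert Hfu.
    apply Cmult_neq_0; trivial. apply RtoC_neq_0. lra. }
  assert (Hmv := move_inward f u (1 - Cmod u) 1 ltac:(lra) Rlt_0_1).
  specialize (Hmv ltac:(intros z Hz; apply Hf; now apply disc_ball with u) Hu0 ltac:(apply Hp; trivial; lra)).
  destruct (small_pos_and _ _ Hmv (small_pos_mult_lt s (s - t) ltac:(lra) ltac:(lra))) as [d [Hd H]].
  destruct (H (d / 2) ltac:(lra)) as [(u' & Hu'1 & Hu'2 & _) Hs].
  assert (EF : F u' = ((1 - d / 2) * s)%R).
  { unfold F. rewrite Hu'1, Hfu, RtoC_mult. field. trivial. }
  specialize (Hmin u'). rewrite EF, re_RtoC, im_RtoC in Hmin.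
  assert (0 < d * s) by (apply Rmult_lt_0_compat; lra).
  assert (K : s <= (1 - d / 2) * s) by (apply Hmin; repeat split; lra). lra.
Qed.

(** Moving both points of a colliding pair inward by the same [t] gives another collision with |f|
    smaller by the factor 1 - t, against minimality. For the minimum to exist, the set of colliding
    points must be closed: this is where local injectivity keeps a partner [v] from merging with
    [u]. *)
Lemma injective_of_Re_pos (f : C -> C) :
  (forall z, Cmod z < 1 -> cderiv f z (C_derive f z) /\ C_derive f z <> 0%C) ->
  (forall z, Cmod z < 1 -> exists m, cderiv (C_derive f) z m) ->
  (forall z, Cmod z < 1 -> z <> 0%C -> 0 < Re (f z / z / C_derive f z)%C) ->
  f 0%C = 0%C ->
  forall z1 z2, Cmod z1 < 1 -> Cmod z2 < 1 -> f z1 = f z2 -> z1 = z2.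
Proof.
intros Hf Hf2 Hp Hf0 z1 z2 Hz1 Hz2 Heq. apply NNPP. intros Hne.
assert (Hf' : forall z, Cmod z < 1 -> exists l, cderiv f z l /\ l <> 0%C).
{ intros z Hz. exists (C_derive f z). now apply Hf. }
assert (Hcont : forall z, Cmod z < 1 -> forall eps, 0 < eps -> exists d, 0 < d /\
   forall v, Cmod (v - z)%C < d -> Cmod (f v - f z)%C < eps).
{ intros z Hz. apply (cderiv_continuous f z (C_derive f z)). now apply Hf. }
assert (Hnz : forall z, Cmod z < 1 -> f z = 0%C -> z = 0%C).
{ intros z Hz E. apply NNPP. intros Hz0. specialize (Hp z Hz Hz0). rewrite E in Hp.
  unfold Cdiv in Hp. rewrite !Cmult_0_l, re_RtoC in Hp. lra. }
set (rho := Rmax (Cmod z1) (Cmod z2)).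
assert (Hrho : rho < 1) by now apply Rmax_lub_lt.
destruct (compact_min (fun u => Cmod u <= rho /\ exists v, Cmod v <= rho /\ v <> u /\ f v = f u) rho
   (fun u => Cmod (f u))) as (u & (Hu & v & Hv & Hvu & Efv) & Hmin).
- tauto.
- intros u Hu. destruct (Rle_dec (Cmod u) rho) as [Hle|Hle].
  (* A neighbourhood of [u] without collisions, by compactness in the partner [v]: near v0 = u by
     local injectivity, near v0 <> u because f(v0) and f(u) are separated. *)
  + assert (HQ : exists d, 0 < d /\ forall u', Cmod (u' - u)%C < d ->
       forall v, Cmod v <= rho -> v <> u' -> f v <> f u').
    { apply (compact_induction (fun v => Cmod v <= rho) rho (fun A => exists d, 0 < d /\
        forall u', Cmod (u' - u)%C < d -> forall v, A v -> v <> u' -> f v <> f u')); trivial.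
      - intros A B HAB [d [Hd H]]. exists d. split; trivial. intros u' Hu' v Hv. apply H; auto.
      - intros A B [d [Hd H]] [e [He H']]. exists (Rmin d e). split; [now apply Rmin_pos|].
        intros u' Hu' v [Hv|Hv].
        + apply H; trivial. apply Rlt_le_trans with (1 := Hu'), Rmin_l.
        + apply H'; trivial. apply Rlt_le_trans with (1 := Hu'), Rmin_r.
      - intros v0. destruct (Rle_dec (Cmod v0) rho) as [Hv0|Hv0].
        + destruct (Ceq_dec v0 u) as [->|Hvu0].
          * destruct (locally_injective f u (1 - Cmod u)) as [e [He Hinj]]; try lra.
            { intros z Hz. apply Hf. now apply disc_ball with u. }
            { apply Hf. lra. }
            { apply Hf2. lra. }
            exists e. split; trivial. exists e. split; trivial.
            intros u' Hu' v [_ Hv] Hvu' E. apply Hvu'. now apply Hinj.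
          * assert (Hfne : f v0 <> f u).
            { intros E. apply Hu. split; trivial. exists v0. auto. }
            apply Cminus_eq_contra in Hfne. apply Cmod_gt_0 in Hfne.
            destruct (Hcont v0 ltac:(lra) (Cmod (f v0 - f u)%C / 2)) as [d1 [Hd1 H1]]; [lra|].
            destruct (Hcont u ltac:(lra) (Cmod (f v0 - f u)%C / 2)) as [d2 [Hd2 H2]]; [lra|].
            exists d1. split; trivial. exists d2. split; trivial.
            intros u' Hu' v [_ Hv] _ E. specialize (H1 v Hv). specialize (H2 u' Hu'). rewrite E in H1.
            assert (Cmod (f v0 - f u)%C <= Cmod (f u' - f v0)%C + Cmod (f u' - f u)%C); [|lra].
            replace (f v0 - f u)%C with (- (f u' - f v0) + (f u' - f u))%C at 1 by ring.
            rewrite <- (Cmod_opp (f u' - f v0)%C). apply Cmod_triangle.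
        + destruct (closed_disc_complement _ _ Hv0) as [d [Hd H]]. exists d. split; trivial.
          exists 1. split; [lra|]. intros u' _ v [Hv1 Hv2]. now elim (H v Hv2). }
    destruct HQ as [d [Hd H]]. exists d. split; trivial.
    intros u' Hu' [_ (v & Hv1 & Hv2 & Hv3)]. now apply (H u' Hu' v).
  + destruct (closed_disc_complement _ _ Hle) as [d [Hd H]]. exists d. split; trivial.
    intros v Hv [Hv1 _]. now apply (H v Hv).
- intros z [Hz _] eps He. destruct (Hcont z ltac:(lra) eps He) as [d [Hd H]]. exists d. split; trivial.
  intros v _ Hv. apply Rle_lt_trans with (2 := H v Hv). apply Cmod_Cmod_minus.
- exists z1. split; [apply Rmax_l|]. exists z2. split; [apply Rmax_r|]. auto.
- destruct (Ceq_dec (f u) 0%C) as [E|E].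
  { apply Hvu. rewrite (Hnz u), (Hnz v); trivial; try lra. now rewrite Efv. }
  assert (Hu0 : u <> 0%C) by (intros ->; now elim E).
  assert (Hv0 : v <> 0%C) by (intros ->; apply E; congruence).
  (* Displacements below half the distance keep the moved points distinct. *)
  set (e := Cmod (u - v)%C / 2).
  assert (He : 0 < e).
  { assert (Huv : (u - v)%C <> 0%C) by (apply Cminus_eq_contra; auto).
    apply Cmod_gt_0 in Huv. unfold e. lra. }
  assert (Hmv : forall z, Cmod z <= rho -> z <> 0%C -> small_pos (fun t => exists u',
     f u' = ((1 - t)%R * f z)%C /\ Cmod u' < Cmod z /\ Cmod (u' - z)%C < e)).
  { intros z Hz Hz0. apply (move_inward f z (1 - Cmod z) e); trivial; try lra.
    - intros y Hy. apply Hf'. now apply disc_ball with z.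
    - apply Hp; trivial. lra. }
  destruct (small_pos_and _ _ (small_pos_and _ _ (Hmv u Hu Hu0) (Hmv v Hv Hv0))
     (small_pos_mult_lt 1 1 Rle_0_1 Rlt_0_1)) as [d [Hd H]].
  destruct (H (d / 2) ltac:(lra)) as [[(u' & A1 & A2 & A3) (v' & B1 & B2 & B3)] Ht].
  apply Cmod_gt_0 in E.
  assert (K : Cmod (f u) <= Cmod (f u')).
  { apply Hmin. split; [lra|]. exists v'. split; [lra|]. split; [|now rewrite A1, B1, Efv].
    intros ->. assert (Cmod (u - v)%C <= Cmod (u' - u)%C + Cmod (u' - v)%C); [|unfold e in *; lra].
    replace (u - v)%C with (- (u' - u) + (u' - v))%C at 1 by ring.
    rewrite <- (Cmod_opp (u' - u)%C). apply Cmod_triangle. }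
  rewrite A1, Cmod_mult, Cmod_R, Rabs_pos_eq in K by lra. nra.
Qed.

(** * Openness and connectedness of the image *)

Lemma C_open_ball (A : C -> Prop) :
  (forall w, A w -> exists d, 0 < d /\ forall w', Cmod (w' - w)%C < d -> A w') <->
  open (T := C_UniformSpace) A.
Proof.
split.
- intros H w Hw. destruct (H w Hw) as [d [Hd H1]].
  (* The balls of [C_UniformSpace] are squares; one of half-side d / sqrt 2 fits into the disc of
     radius d. *)
  assert (Hs : 0 < sqrt 2) by (apply sqrt_lt_R0; lra).
  exists (mkposreal _ (Rdiv_lt_0_compat _ _ Hd Hs)). intros w' Hw'. apply H1.
  apply C_NormedModule_mixin_compat2 in Hw'. simpl in Hw'.
  now replace (sqrt 2 * (d / sqrt 2)) with d in Hw' by (field; lra).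
- intros H w Hw. destruct (H w Hw) as [d H1]. exists d. split; [apply cond_pos|].
  intros w' Hw'. apply H1. now apply C_NormedModule_mixin_compat1.
Qed.

Lemma open_image (f : C -> C) :
  (forall z, Cmod z < 1 -> exists l, cderiv f z l /\ l <> 0%C) ->
  open (T := C_UniformSpace) (image unit_disc f).
Proof.
intros Hf. apply C_open_ball. intros w [z0 [Hz0 <-]]. unfold unit_disc in Hz0.
destruct (quantitative_open_mapping f z0 (1 - Cmod z0)) as (k & eta & _ & Heta & H); [lra| |].
- intros z Hz. apply Hf. now apply disc_ball with z0.
- exists eta. split; trivial. intros w Hw. destruct (H w Hw) as (z & H1 & H2 & _).
  exists z. split; trivial. now apply disc_ball with z0.
Qed.

(** Connectedness of the interval [0, 1], transported by [f] along the segment joining preimages of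
    the two given points; [s] is the last parameter approached by [U]. *)
Lemma connected_image (f : C -> C) :
  (forall z, Cmod z < 1 -> exists l, cderiv f z l) -> connected (image unit_disc f).
Proof.
intros Hf U V HU HV Hcov (w1 & [z1 [Hz1 E1]] & Hw1) (w2 & [z2 [Hz2 E2]] & Hw2).
unfold unit_disc in *. pose (g := fun t : R => (z1 + t * (z2 - z1))%C).
assert (Hg : forall t, 0 <= t <= 1 -> Cmod (g t) < 1).
{ intros t Ht. rewrite <- (Cminus_0_r (g t)). apply ball_segment; trivial; now rewrite Cminus_0_r. }
assert (Hloc : forall A, open (T := C_UniformSpace) A -> forall t, 0 <= t <= 1 -> A (f (g t)) ->
  exists d, 0 < d /\ forall s, Rabs (s - t) < d -> A (f (g s))).
{ intros A HA t Ht HAt.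
  destruct (proj2 (C_open_ball A) HA _ HAt) as [eps [He H]].
  destruct (Hf (g t) (Hg t Ht)) as [l Hl].
  destruct (cderiv_continuous f (g t) l Hl eps He) as [d [Hd H1]].
  pose proof (Cmod_ge_0 (z2 - z1)%C) as Hn.
  exists (d / (Cmod (z2 - z1)%C + 1)). split; [apply Rdiv_lt_0_compat; lra|].
  intros s Hs. apply H, H1.
  replace (g s - g t)%C with ((s - t)%R * (z2 - z1))%C by (unfold g; rewrite RtoC_minus; ring).
  rewrite Cmod_mult, Cmod_R.
  apply Rmult_lt_compat_r with (r := Cmod (z2 - z1)%C + 1) in Hs; [|lra].
  replace (d / (Cmod (z2 - z1)%C + 1) * (Cmod (z2 - z1)%C + 1)) with d in Hs by (field; lra).
  pose proof (Rabs_pos (s - t)). lra. }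
assert (Hin : forall t, 0 <= t <= 1 -> image (fun z => Cmod z < 1) f (f (g t))).
{ intros t Ht. exists (g t). split; trivial. now apply Hg. }
assert (G0 : f (g 0) = w1) by (rewrite <- E1; f_equal; unfold g; ring).
assert (G1 : f (g 1) = w2) by (rewrite <- E2; f_equal; unfold g; ring).
destruct (completeness (fun t => 0 <= t <= 1 /\ U (f (g t)))) as [s [Hs1 Hs2]].
- exists 1. intros t [Ht _]. lra.
- exists 0. rewrite G0. split; [lra|trivial].
- assert (Hs : 0 <= s <= 1).
  { split.
    - apply Hs1. rewrite G0. split; [lra|trivial].
    - apply Hs2. intros t [Ht _]. lra. }
  (* If f(g s) is in [U], openness pushes past [s] unless s = 1, and then w2 lies in both sets. If
     it is in [V], parameters of [U] just below or at [s] also land in [V]. *)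
  destruct (Hcov _ (Hin s Hs)) as [HUs|HVs].
  + destruct (Rle_lt_or_eq_dec s 1 (proj2 Hs)) as [Hlt|Heq].
    * destruct (Hloc U HU s Hs HUs) as [d [Hd H]].
      assert (Hm : 0 < Rmin d (1 - s)) by (apply Rmin_pos; lra).
      generalize (Rmin_l d (1 - s)) (Rmin_r d (1 - s)). intros Hm1 Hm2.
      assert (K : s + Rmin d (1 - s) / 2 <= s).
      { apply Hs1. split; [lra|]. apply H. replace (s + Rmin d (1 - s) / 2 - s) with (Rmin d (1 - s) / 2) by ring.
        rewrite Rabs_pos_eq; lra. }
      lra.
    * exists w2. rewrite <- G1, <- Heq at 1. split; [now apply Hin|]. split; trivial. now rewrite <- G1, <- Heq.
  + destruct (Hloc V HV s Hs HVs) as [d [Hd H]].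
    assert (exists t, s - d < t /\ 0 <= t <= 1 /\ U (f (g t))) as (t & Ht1 & Ht2 & Ht3).
    { apply NNPP. intros Hno. assert (K : s <= s - d); [|lra].
      apply Hs2. intros t [Ht HUt]. apply Rnot_lt_le. intros Hlt. apply Hno. now exists t. }
    exists (f (g t)). split; [now apply Hin|]. split; trivial. apply H.
    specialize (Hs1 t (conj Ht2 Ht3)). rewrite Rabs_left1; lra.
Qed.

Theorem corollary1p1 (f : C -> C)
  (hf : class_A1 f)
  (hf' : forall z : C, unit_disc z -> C_derive f z <> 0%C)
  (hIm : forall z : C, unit_disc z ->
     Rabs (Im (z * C_derive (C_derive f) z / C_derive f z)%C) < sqrt 3) :
  starlike f.
Proof.
destruct (class_A1_cderiv f hf) as (Hf & Hf0 & _).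
assert (Hfl : forall z, Cmod z < 1 -> exists l, cderiv f z l /\ l <> 0%C).
{ intros z Hz. exists (C_derive f z). split; [now apply Hf|now apply hf']. }
assert (Hp : forall z, Cmod z < 1 -> z <> 0%C -> 0 < Re (f z / z / C_derive f z)%C).
{ intros z Hz Hz0. rewrite <- (quot_neq_0 f 1) by trivial. now apply Re_quot_pos. }
split; [|split].
- split; [apply hf|]. apply injective_of_Re_pos; trivial.
  + intros z Hz. split; [now apply Hf|now apply hf'].
  + intros z Hz. exists (C_derive (C_derive f) z). now apply class_A1_cderiv2.
- split; [now apply open_image|]. split.
  + exists (f 0%C), 0%C. split; trivial. unfold unit_disc. rewrite Cmod_0. lra.
  + apply connected_image. intros z Hz. exists (C_derive f z). now apply Hf.
- now apply starlike_of_Re_pos.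
Qed.
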